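(* Let $(A_\mu,B_\nu,\vartriangleright,\vartriangleleft,\rightharpoonup,\leftharpoonup)$ be a matched pair of associative algebras over a field of characteristic $0$. Then the pair $(\bigoplus_{n\ge0}\mathrm{Hom}(B^{\otimes n+1},A),\{l_k\}_{k=1}^\infty)$ (with $\mathrm{Hom}(B^{\otimes n+1},A)$ in degree $n$) is an $L_\infty$-algebra, where $l_k=0$ for $k\ne1,2$ and, for $f\in\mathrm{Hom}(B^{\otimes m},A)$, $g\in\mathrm{Hom}(B^{\otimes n},A)$, \begin{align*} l_1(f)(x_1,\ldots,x_{m+1})={}&(-1)^{m+1}x_1\rightharpoonup f(x_2,\ldots,x_{m+1})+f(x_1,\ldots,x_m)\leftharpoonup x_{m+1}\\ &+\sum_{i=1}^m(-1)^{i+m+1}f(x_1,\ldots,x_{i-1},x_i\cdot_B x_{i+1},\ldots,x_{m+1}), \end{align*} \begin{align*} l_2(f,g)(x_1,\ldots,x_{m+n})={}&(-1)^m\sum_{i=1}^m(-1)^{(i-1)n}f\big(x_1,\ldots,x_{i-1},g(x_i,\ldots,x_{i+n-1})\vartriangleright x_{i+n},\ldots,x_{m+n}\big)\\ &-(-1)^m\sum_{i=1}^m(-1)^{in}f\big(x_1,\ldots,x_{i-1},x_i\vartriangleleft g(x_{i+1},\ldots,x_{i+n}),x_{i+n+1},\ldots,x_{m+n}\big)\\ &-(-1)^{m(n+1)}\Big\{\sum_{i=1}^n(-1)^{(i-1)m}g\big(x_1,\ldots,x_{i-1},f(x_i,\ldots,x_{i+m-1})\vartriangleright x_{i+m},\ldots,x_{m+n}\big)\\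 &\qquad-\sum_{i=1}^n(-1)^{im}g\big(x_1,\ldots,x_{i-1},x_i\vartriangleleft f(x_{i+1},\ldots,x_{i+m}),x_{i+m+1},\ldots,x_{m+n}\big)\Big\}\\ &+(-1)^{m(n+1)}f(x_1,\ldots,x_m)\cdot_A g(x_{m+1},\ldots,x_{m+n})\\ &-(-1)^m g(x_1,\ldots,x_n)\cdot_A f(x_{n+1},\ldots,x_{m+n}). \end{align*} Moreover, a linear map $r:B\to A$ is a deformation map in $(A_\mu,B_\nu,\vartriangleright,\vartriangleleft,\rightharpoonup,\leftharpoonup)$ if and only if $r$ is a Maurer-Cartan element of this $L_\infty$-algebra.
   Context: A matched pair of associative algebras is a tuple $(A_\mu,B_\nu,\vartriangleright,\vartriangleleft,\rightharpoonup,\leftharpoonup)$ of two (not necessarily unital) associative algebras $A_\mu=(A,\cdot_A)$, $B_\nu=(B,\cdot_B)$ and bilinear maps $\vartriangleright:A\times B\to B$, $\vartriangleleft:B\times A\to B$, $\rightharpoonup:B\times A\to A$, $\leftharpoonup:A\times B\to A$ such that $(B,\vartriangleright,\vartriangleleft)$ is an $A_\mu$-bimodule, $(A,\rightharpoonup,\leftharpoonup)$ is a $B_\nu$-bimodule, and the multiplication $(a,x)\Join(b,y)=(a\cdot_A b+a\leftharpoonup y+x\rightharpoonup b,\ x\cdot_B y+a\vartriangleright y+x\vartriangleleft b)$ on $A\oplus B$ is associative. A deformation map in it is a linear map $r:B\to A$ with $r(x)\cdot_A r(y)+r(x)\leftharpoonup y+x\rightharpoonup r(y)=r\big(x\cdot_B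 y+r(x)\vartriangleright y+x\vartriangleleft r(y)\big)$ for all $x,y\in B$. An $L_\infty$-algebra is a graded vector space $\mathcal G$ with graded symmetric (with Koszul sign $\epsilon(\sigma)$) degree $1$ maps $l_k:\mathcal G^{\otimes k}\to\mathcal G$, $k\ge1$, such that for all $N\ge1$ and homogeneous $x_1,\ldots,x_N$: $\sum_{i=1}^N\sum_{\sigma\in Sh(i,N-i)}\epsilon(\sigma)\,l_{N-i+1}(l_i(x_{\sigma(1)},\ldots,x_{\sigma(i)}),x_{\sigma(i+1)},\ldots,x_{\sigma(N)})=0$, where $Sh(i,N-i)$ is the set of $(i,N-i)$-shuffles. A Maurer-Cartan element is $\alpha\in\mathcal G_0$ with $\sum_{k\ge1}\frac1{k!}l_k(\alpha,\ldots,\alpha)=0$. *)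

(* Defs.v *)
From HB Require Import structures.
From mathcomp Require Import all_boot all_order all_fingroup all_algebra.
From mathcomp Require Import boolp classical_sets functions cardinality.

Set Implicit Arguments.
Unset Strict Implicit.
Unset Printing Implicit Defensive.

Import GRing.Theory.
Local Open Scope ring_scope.

Section Multilinear.
Variables (K : fieldType) (U V : lmodType K).

Definition tset n (x : n.-tuple U) (i : 'I_n) (u : U) : n.-tuple U :=
  [tuple if j == i then u else tnth x j | j < n].

Definition multilinear n (f : n.-tuple U -> V) : Prop :=
  forall (i : 'I_n) (x : n.-tuple U), linear (fun u => f (tset x i u)).

(* Only used on sequences [s] of length [n], so that the default value of
   [nth] is never reached; it spares casts between equal arities. *)
Definition app n (f : n.-tuple U -> V) (s : seq U) : V :=
  f [tuple s`_i | i < n].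

(* Linear maps from the n-th tensor power of U to V, given as n-linear maps. *)
Record multihom (n : nat) := MultiHom {
  multihom_fun :> n.-tuple U -> V;
  multihom_multilinear : multilinear multihom_fun }.

Lemma multihom_ext n (f g : multihom n) : (forall x, f x = g x) -> f = g.
Proof.
case: f g => f Pf [g Pg] /= /funext fg; rewrite fg in Pf *.
by congr MultiHom; exact: Prop_irrelevance.
Qed.

HB.instance Definition _ n := gen_eqMixin (multihom n).
HB.instance Definition _ n := gen_choiceMixin (multihom n).

Lemma multilinear0 n : multilinear (fun _ : n.-tuple U => 0 : V).
Proof. by move=> i x a u v; rewrite scaler0 addr0. Qed.

Lemma multilinearD n (f g : n.-tuple U -> V) :
  multilinear f -> multilinear g -> multilinear (fun x => f x + g x).
Proof. by move=> Pf Pg i x a u v; rewrite Pf Pg scalerDr addrACA. Qed.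

Lemma multilinearZ n a (f : n.-tuple U -> V) :
  multilinear f -> multilinear (fun x => a *: f x).
Proof.
by move=> Pf i x b u v; rewrite Pf scalerDr !scalerA mulrC.
Qed.

Lemma multilinearN n (f : n.-tuple U -> V) :
  multilinear f -> multilinear (fun x => - f x).
Proof. by move=> Pf i x a u v; rewrite Pf opprD scalerN. Qed.

Lemma multilinear_sum n (I : eqType) (r : seq I) (f : I -> n.-tuple U -> V) :
  {in r, forall i, multilinear (f i)} ->
  multilinear (fun x => \sum_(i <- r) f i x).
Proof.
move=> Pf j x a u v; rewrite scaler_sumr -big_split /=.
by apply: eq_big_seq => i ir; exact: Pf.
Qed.

Definition multihom_zero n : multihom n := MultiHom (@multilinear0 n).
Definition multihom_add n (f g : multihom n) : multihom n :=
  MultiHom (multilinearD (multihom_multilinear f) (multihom_multilinear g)).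
Definition multihom_opp n (f : multihom n) : multihom n :=
  MultiHom (multilinearN (multihom_multilinear f)).
Definition multihom_scale n a (f : multihom n) : multihom n :=
  MultiHom (multilinearZ a (multihom_multilinear f)).

Lemma multihom_addA n : associative (@multihom_add n).
Proof. by move=> f g h; apply: multihom_ext => x /=; rewrite addrA. Qed.
Lemma multihom_addC n : commutative (@multihom_add n).
Proof. by move=> f g; apply: multihom_ext => x /=; rewrite addrC. Qed.
Lemma multihom_add0 n : left_id (@multihom_zero n) (@multihom_add n).
Proof. by move=> f; apply: multihom_ext => x /=; rewrite add0r. Qed.
Lemma multihom_addN n :
  left_inverse (@multihom_zero n) (@multihom_opp n) (@multihom_add n).
Proof. by move=> f; apply: multihom_ext => x /=; rewrite addNr. Qed.

HB.instance Definition _ n := GRing.isZmodule.Build (multihom n)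
  (@multihom_addA n) (@multihom_addC n) (@multihom_add0 n) (@multihom_addN n).

Lemma multihom_scaleA n a b (f : multihom n) :
  multihom_scale a (multihom_scale b f) = multihom_scale (a * b) f.
Proof. by apply: multihom_ext => x /=; rewrite scalerA. Qed.
Lemma multihom_scale1 n : left_id 1 (@multihom_scale n).
Proof. by move=> f; apply: multihom_ext => x /=; rewrite scale1r. Qed.
Lemma multihom_scaleDr n : right_distributive (@multihom_scale n) +%R.
Proof. by move=> a f g; apply: multihom_ext => x /=; rewrite scalerDr. Qed.
Lemma multihom_scaleDl n (f : multihom n) :
  {morph (@multihom_scale n)^~ f : a b / a + b}.
Proof. by move=> a b; apply: multihom_ext => x /=; rewrite scalerDl. Qed.

HB.instance Definition _ n := GRing.Zmodule_isLmodule.Build K (multihom n)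
  (@multihom_scaleA n) (@multihom_scale1 n)
  (@multihom_scaleDr n) (@multihom_scaleDl n).

Lemma linear_multilinear1 (r : {linear U -> V}) :
  multilinear (fun x : 1.-tuple U => r (thead x)).
Proof.
move=> i x a u v; rewrite /thead !tnth_mktuple.
by rewrite (_ : ord0 == i) ?linearP //; rewrite [i]ord1.
Qed.

Definition multihom_of_linear (r : {linear U -> V}) : multihom 1 :=
  MultiHom (linear_multilinear1 r).

End Multilinear.
Arguments multihom {K} U V n.

(* [lin3 a s1 s2 s3]: the sequences differ at a single position, where the
   entry of [s3] is [a *: u + v] for the entries [u] of [s1] and [v] of [s2]. *)
Section Lin3.
Variables (K : fieldType) (U : lmodType K).
Implicit Types (s p q : seq U) (a : K).

Definition lin3 a s1 s2 s3 := exists p u v q,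
  [/\ s1 = p ++ u :: q, s2 = p ++ v :: q & s3 = p ++ (a *: u + v) :: q].

Lemma lin3_size a s1 s2 s3 :
  lin3 a s1 s2 s3 -> size s2 = size s1 /\ size s3 = size s1.
Proof. by move=> [p [u [v [q [-> -> ->]]]]]; rewrite !size_cat. Qed.

Lemma lin3_catl a t s1 s2 s3 :
  lin3 a s1 s2 s3 -> lin3 a (t ++ s1) (t ++ s2) (t ++ s3).
Proof.
by move=> [p [u [v [q [-> -> ->]]]]]; exists (t ++ p), u, v, q; rewrite !catA.
Qed.

Lemma lin3_catr a t s1 s2 s3 :
  lin3 a s1 s2 s3 -> lin3 a (s1 ++ t) (s2 ++ t) (s3 ++ t).
Proof.
move=> [p [u [v [q [-> -> ->]]]]]; exists p, u, v, (q ++ t).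
by rewrite -!catA.
Qed.

Lemma lin3_split n a s1 s2 s3 : lin3 a s1 s2 s3 ->
  [/\ lin3 a (take n s1) (take n s2) (take n s3),
      drop n s1 = drop n s3 & drop n s2 = drop n s3] \/
  [/\ take n s1 = take n s3, take n s2 = take n s3 &
      lin3 a (drop n s1) (drop n s2) (drop n s3)].
Proof.
move=> [p [u [v [q [-> -> ->]]]]]; rewrite !take_cat !drop_cat.
case: ltnP => pn.
  right; split=> //; by exists (drop n p), u, v, q.
have [->|] := posnP (n - size p)%N.
  by right; rewrite !take0 !drop0; split=> //; exists [::], u, v, q.
case: (n - size p)%N => // k _; left; split=> //=.
by exists p, u, v, (take k q).
Qed.

Lemma lin3_head a s1 s2 s3 :
  lin3 a s1 s2 s3 -> size s1 = 1%N -> s3`_0 = a *: s1`_0 + s2`_0.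
Proof.
move=> [[|y p] [u [v [q [-> -> ->]]]]] //=.
by rewrite size_cat /= addnS.
Qed.

Lemma tset_lin3 n (x : n.-tuple U) i a (u v : U) :
  lin3 a (tset x i u) (tset x i v) (tset x i (a *: u + v)).
Proof.
have tsetE w : tset x i w = take i x ++ w :: drop i.+1 x :> seq U.
  have szi : size (take i x) = i.
    by rewrite size_takel // size_tuple; exact/ltnW/ltn_ord.
  have szt : size (tset x i w) = n by rewrite size_map size_enum_ord.
  apply: (@eq_from_nth _ 0) => [|j].
    rewrite szt size_cat /= size_drop szi size_tuple -subSn // subSS.
    by rewrite subnKC //; exact/ltnW/ltn_ord.
  rewrite szt => jn; rewrite nth_cat szi -[j]/(val (Ordinal jn)).
  rewrite -tnth_nth tnth_mktuple -val_eqE /=.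
  case: (ltngtP j i) => [ji|ij|<-]; last by rewrite subnn.
    by rewrite nth_take // (tnth_nth 0).
  case: j jn ij => // j jn ij; rewrite subSn //= nth_drop (tnth_nth 0) /=.
  by rewrite addSn subnKC.
by exists (take i x), u, v, (drop i.+1 x); rewrite !tsetE.
Qed.

Definition lin3_on (V : lmodType K) n (F : seq U -> V) :=
  forall a s1 s2 s3, lin3 a s1 s2 s3 -> size s1 = n -> F s3 = a *: F s1 + F s2.

Lemma multilinear_lin3 (V : lmodType K) n (F : seq U -> V) :
  lin3_on n F -> multilinear (fun x : n.-tuple U => F x).
Proof.
by move=> PF i x a u v; apply: PF (tset_lin3 _ _ _ _ _) _; rewrite size_tuple.
Qed.

Lemma lin3_on_head : lin3_on 1 (fun s => s`_0).
Proof. by move=> a s1 s2 s3; exact: lin3_head. Qed.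

Lemma lin3_on_app (V : lmodType K) n (f : multihom U V n) : lin3_on n (app f).
Proof.
move=> a _ _ _ [p [u [v [q [-> -> ->]]]]]; rewrite size_cat /= => pn.
have ltpn : (size p < n)%N by rewrite -pn addnS ltnS leq_addr.
pose x : n.-tuple U := [tuple (p ++ 0 :: q)`_j | j < n].
have E w : app f (p ++ w :: q) = f (tset x (Ordinal ltpn) w).
  rewrite /app; congr (multihom_fun f); apply: eq_from_tnth => j.
  rewrite !tnth_mktuple -val_eqE /= !nth_cat.
  case: eqP => [->|/eqP jp]; first by rewrite ltnn subnn.
  case: ltnP => // pj; suff: (0 < j - size p)%N by case: (j - size p)%N.
  by rewrite subn_gt0 ltn_neqAle eq_sym jp.
by rewrite !E multihom_multilinear.
Qed.

Lemma app0 (V : lmodType K) n (f : multihom U V n) p q :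
  (size p < n)%N -> app f (p ++ 0 :: q) = 0.
Proof.
move=> pn; rewrite /app; set t := [tuple _ | _ < n].
have -> : t = tset t (Ordinal pn) (- 1 *: 0 + 0).
  rewrite scaler0 addr0; apply: eq_from_tnth => j; rewrite [RHS]tnth_mktuple.
  by case: eqP => // ->; rewrite tnth_mktuple nth_cat ltnn subnn.
by rewrite multihom_multilinear scaleN1r addNr.
Qed.

Lemma lin3_on_eq (V : lmodType K) n (F F' : seq U -> V) :
  (forall s, size s = n -> F s = F' s) -> lin3_on n F' -> lin3_on n F.
Proof.
move=> FF' PF' a s1 s2 s3 s123 sz; have [sz2 sz3] := lin3_size s123.
by rewrite !FF' ?sz2 ?sz3 //; exact: PF'.
Qed.

Lemma lin3_on_bilinear (V W Z : lmodType K) (b : {bilinear V -> W -> Z})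
    k l (F : seq U -> V) (G : seq U -> W) :
  lin3_on k F -> lin3_on l G ->
  lin3_on (k + l) (fun s => b (F (take k s)) (G (drop k s))).
Proof.
move=> PF PG a s1 s2 s3 s123 sz.
have [[P E1 E2]|[E1 E2 P]] := lin3_split k s123.
  rewrite E1 E2 (PF _ _ _ _ P) ?linearPl//.
  by rewrite size_takel // sz leq_addr.
rewrite E1 E2 (PG _ _ _ _ P) ?linearPr//.
by rewrite size_drop sz addKn.
Qed.

Lemma lin3_on_insert (V : lmodType K) m n (f : multihom U V m)
    (phi : seq U -> U) o :
  lin3_on n.+1 phi -> (o < m)%N ->
  lin3_on (m + n) (fun s =>
    app f (take o s ++ phi (take n.+1 (drop o s)) :: drop n.+1 (drop o s))).
Proof.
move=> Pphi om a s1 s2 s3 s123 sz.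
have [sz2 sz3] := lin3_size s123.
have szF s : size s = (m + n)%N ->
    size (take o s ++ phi (take n.+1 (drop o s)) :: drop n.+1 (drop o s)) = m.
  move=> szs; rewrite size_cat /= !size_drop size_takel; last first.
    by rewrite szs (leq_trans (ltnW om)) ?leq_addr.
  have -> : (size s - o - n.+1 = m - o.+1)%N.
    by rewrite szs -subnDA addnS -addSn subnDr.
  by rewrite -subSn // subSS subnKC // ltnW.
apply: (@lin3_on_app _ _ f) _ (szF _ sz).
have [[P1 E1 E2]|[-> -> P1]] := lin3_split o s123.
  by rewrite E1 E2; exact: lin3_catr.
apply: lin3_catl; have [[P2 E1 E2]|[-> -> P2]] := lin3_split n.+1 P1.
  rewrite E1 E2.
  exists [::], (phi (take n.+1 (drop o s1))), (phi (take n.+1 (drop o s2))).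
  eexists; split => //=; congr (_ :: _); apply: Pphi P2 _.
  rewrite size_takel // size_drop sz addnC -addnBA; last exact: ltnW.
  by rewrite -addn1 leq_add2l subn_gt0.
by rewrite -![_ :: drop _ _]cat1s; exact: lin3_catl.
Qed.

End Lin3.

Section DirectSum.
Variables (K : fieldType) (G : int -> lmodType K).

Record dsum := DSum {
  dsum_fun :> forall d, G d;
  dsum_fin : finite_set [set d | dsum_fun d != 0] }.

Lemma dsum_ext (v w : dsum) : (forall d, v d = w d) -> v = w.
Proof.
case: v w => v Pv [w Pw] /= vw.
have {}vw : v = w by exact: functional_extensionality_dep.
by rewrite vw in Pv *; congr DSum; exact: Prop_irrelevance.
Qed.

HB.instance Definition _ := gen_eqMixin dsum.
HB.instance Definition _ := gen_choiceMixin dsum.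

Lemma dsum_fin0 : finite_set [set d | (0 : G d) != 0].
Proof. by apply: (@sub_finite_set _ _ set0) => // d /=; rewrite eqxx. Qed.

Lemma dsum_finD (v w : dsum) : finite_set [set d | v d + w d != 0].
Proof.
apply: (@sub_finite_set _ _
  ([set d | v d != 0] `|` [set d | w d != 0])%classic).
  move=> d /=; have [->|] := eqVneq (v d) 0; last by left.
  by rewrite add0r; right.
by rewrite finite_setU; split; exact: dsum_fin.
Qed.

Lemma dsum_finZ a (v : dsum) : finite_set [set d | a *: v d != 0].
Proof.
apply: sub_finite_set (dsum_fin v) => d /=.
by apply: contra_neq => ->; rewrite scaler0.
Qed.

Lemma dsum_finN (v : dsum) : finite_set [set d | - v d != 0].
Proof. by apply: sub_finite_set (dsum_fin v) => d /=; rewrite oppr_eq0. Qed.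

Definition dsum_zero := DSum dsum_fin0.
Definition dsum_add v w := DSum (dsum_finD v w).
Definition dsum_opp v := DSum (dsum_finN v).
Definition dsum_scale a v := DSum (dsum_finZ a v).

Lemma dsum_addA : associative dsum_add.
Proof. by move=> u v w; apply: dsum_ext => d /=; rewrite addrA. Qed.
Lemma dsum_addC : commutative dsum_add.
Proof. by move=> v w; apply: dsum_ext => d /=; rewrite addrC. Qed.
Lemma dsum_add0 : left_id dsum_zero dsum_add.
Proof. by move=> v; apply: dsum_ext => d /=; rewrite add0r. Qed.
Lemma dsum_addN : left_inverse dsum_zero dsum_opp dsum_add.
Proof. by move=> v; apply: dsum_ext => d /=; rewrite addNr. Qed.

HB.instance Definition _ := GRing.isZmodule.Build dsum
  dsum_addA dsum_addC dsum_add0 dsum_addN.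

Lemma dsum_scaleA a b v : dsum_scale a (dsum_scale b v) = dsum_scale (a * b) v.
Proof. by apply: dsum_ext => d /=; rewrite scalerA. Qed.
Lemma dsum_scale1 : left_id 1 dsum_scale.
Proof. by move=> v; apply: dsum_ext => d /=; rewrite scale1r. Qed.
Lemma dsum_scaleDr : right_distributive dsum_scale +%R.
Proof. by move=> a v w; apply: dsum_ext => d /=; rewrite scalerDr. Qed.
Lemma dsum_scaleDl v : {morph dsum_scale^~ v : a b / a + b}.
Proof. by move=> a b; apply: dsum_ext => d /=; rewrite scalerDl. Qed.

HB.instance Definition _ := GRing.Zmodule_isLmodule.Build K dsum
  dsum_scaleA dsum_scale1 dsum_scaleDr dsum_scaleDl.

Definition homogeneous (d : int) (v : dsum) : Prop :=
  forall e, e != d -> v e = 0.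

Lemma dinj_fin d (g : G d) :
  finite_set [set e | dfwith (fun e => 0 : G e) g e != 0].
Proof.
apply: sub_finite_set (finite_set1 d) => e /=.
by case: dfwithP => [//|{}e _]; rewrite eqxx.
Qed.

Definition dinj d (g : G d) : dsum := DSum (dinj_fin g).

End DirectSum.

Section Linfinity.
Variables (K : fieldType) (G : int -> lmodType K).

(* The sign with x_1 ... x_N = koszul d s x_(s 1) ... x_(s N) in the graded
   symmetric algebra, for x_i of degree d i. *)
Definition koszul N (d : 'I_N -> int) (s : 'S_N) : K :=
  \prod_(i < N) \prod_(j < N | (i < j)%N && (s j < s i)%N)
    (-1) ^ (d (s i) * d (s j)).

Definition shuffles N (i : nat) : {set 'S_N} :=
  [set s : 'S_N | [forall a : 'I_N, forall b : 'I_N,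
    (a < b)%N && ((b < i)%N || (i <= a)%N) ==> (s a < s b)%N]].

(* The value of [l 0] is irrelevant. *)
Record is_Linfty (l : forall k, k.-tuple (dsum G) -> dsum G) : Prop := {
  Linfty_multilinear : forall k, (0 < k)%N -> multilinear (l k);
  Linfty_degree : forall k (d : 'I_k -> int) (x : k.-tuple (dsum G)),
    (0 < k)%N -> (forall i, homogeneous (d i) (tnth x i)) ->
    homogeneous (\sum_(i < k) d i + 1) (l k x);
  Linfty_symmetric :
    forall k (d : 'I_k -> int) (x : k.-tuple (dsum G)) (s : 'S_k),
    (0 < k)%N -> (forall i, homogeneous (d i) (tnth x i)) ->
    l k x = koszul d s *: l k [tuple tnth x (s i) | i < k];
  Linfty_jacobi : forall N (d : 'I_N -> int) (x : N.-tuple (dsum G)),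
    (0 < N)%N -> (forall i, homogeneous (d i) (tnth x i)) ->
    \sum_(1 <= i < N.+1) \sum_(s in shuffles N i)
      (let y := [tuple tnth x (s j) | j < N] in
       koszul d s *:
         app (l (N - i + 1)%N) (app (l i) (take i y) :: drop i y)) = 0 }.

(* The sum over k >= 1 is required to have finitely many nonzero terms. *)
Definition maurer_cartan (l : forall k, k.-tuple (dsum G) -> dsum G)
    (alpha : dsum G) : Prop :=
  homogeneous 0 alpha /\
  exists n : nat,
    (forall k, (n < k)%N -> l k [tuple alpha | i < k] = 0) /\
    \sum_(1 <= k < n.+1) (k`!%:R : K)^-1 *: l k [tuple alpha | i < k] = 0.

End Linfinity.

Record assoc_algebra (K : fieldType) (A : lmodType K) := AssocAlgebra {
  amul :> {bilinear A -> A -> A};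
  amulA : associative amul }.

Record is_bimodule (K : fieldType) (A V : lmodType K) (mu : assoc_algebra A)
    (lact : {bilinear A -> V -> V}) (ract : {bilinear V -> A -> V}) : Prop := {
  bimod_left : forall a b v, lact (mu a b) v = lact a (lact b v);
  bimod_right : forall v a b, ract v (mu a b) = ract (ract v a) b;
  bimod_mid : forall a v b, ract (lact a v) b = lact a (ract v b) }.

(* [mp_tr] is the right triangle A x B -> B, [mp_tl] the left triangle
   B x A -> B, [mp_rh] the right harpoon B x A -> A and [mp_lh] the left
   harpoon A x B -> A. *)
Record matched_pair (K : fieldType) (A B : lmodType K) := MatchedPair {
  mp_mu : assoc_algebra A;
  mp_nu : assoc_algebra B;
  mp_tr : {bilinear A -> B -> B};
  mp_tl : {bilinear B -> A -> B};
  mp_rh : {bilinear B -> A -> A};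
  mp_lh : {bilinear A -> B -> A};
  mp_bimodB : is_bimodule mp_mu mp_tr mp_tl;
  mp_bimodA : is_bimodule mp_nu mp_rh mp_lh;
  mp_bowtieA : associative (fun u v : A * B =>
    (mp_mu u.1 v.1 + mp_lh u.1 v.2 + mp_rh u.2 v.1,
     mp_nu u.2 v.2 + mp_tr u.1 v.2 + mp_tl u.2 v.1)) }.

Definition deformation_map (K : fieldType) (A B : lmodType K)
    (M : matched_pair A B) (r : {linear B -> A}) : Prop :=
  forall x y : B,
    mp_mu M (r x) (r y) + mp_lh M (r x) y + mp_rh M x (r y) =
    r (mp_nu M x y + mp_tr M (r x) y + mp_tl M x (r y)).

Section Cochains.
Variables (K : fieldType) (A B : lmodType K) (M : matched_pair A B).

Local Notation "a '·A' b" := (mp_mu M a b) (at level 40).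
Local Notation "x '·B' y" := (mp_nu M x y) (at level 40).
Local Notation "a '▷' y" := (mp_tr M a y) (at level 40).
Local Notation "x '◁' b" := (mp_tl M x b) (at level 40).
Local Notation "x '⇀' b" := (mp_rh M x b) (at level 40).
Local Notation "a '↼' y" := (mp_lh M a y) (at level 40).

(* Indices start at 1: [ent x i] is x_i, and [seg x i j] is x_i, ..., x_j,
   which is empty when j < i. *)
Definition ent (x : seq B) (i : nat) : B := x`_i.-1.
Definition seg (x : seq B) (i j : nat) : seq B := drop i.-1 (take j x).

Definition l1_fun m (f : multihom B A m) (x : seq B) : A :=
  (-1) ^+ (m + 1) *: (ent x 1 ⇀ app f (seg x 2 (m + 1)))
  + (app f (seg x 1 m) ↼ ent x (m + 1))
  + \sum_(1 <= i < m.+1) (-1) ^+ (i + m + 1) *: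
    app f (seg x 1 (i - 1) ++ (ent x i ·B ent x (i + 1)) ::
           seg x (i + 2) (m + 1)).

Definition insert_fun m n (f : multihom B A m) (g : multihom B A n)
    (x : seq B) : A :=
  \sum_(1 <= i < m.+1) (-1) ^+ ((i - 1) * n) *:
    app f (seg x 1 (i - 1) ++ (app g (seg x i (i + n - 1)) ▷ ent x (i + n)) ::
           seg x (i + n + 1) (m + n))
  - \sum_(1 <= i < m.+1) (-1) ^+ (i * n) *:
    app f (seg x 1 (i - 1) ++ (ent x i ◁ app g (seg x (i + 1) (i + n))) ::
           seg x (i + n + 1) (m + n)).

Definition l2_fun m n (f : multihom B A m) (g : multihom B A n)
    (x : seq B) : A :=
  (-1) ^+ m *: insert_fun f g x
  - (-1) ^+ (m * (n + 1)) *: insert_fun g f x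
  + (-1) ^+ (m * (n + 1)) *:
      (app f (seg x 1 m) ·A app g (seg x (m + 1) (m + n)))
  - (-1) ^+ m *:
      (app g (seg x 1 n) ·A app f (seg x (n + 1) (m + n))).

Lemma seg1 (x : seq B) i : seg x 1 i = take i x.
Proof. by rewrite /seg drop0. Qed.

Lemma seg_end (x : seq B) i j : size x = j -> seg x i.+1 j = drop i x.
Proof. by move=> <-; rewrite /seg take_size. Qed.

Lemma insert_multilinear m n (f : multihom B A m) (phi y : seq B -> B) i :
  i \in index_iota 1 m.+1 -> lin3_on n.+1 phi ->
  (forall x, y x = phi (take n.+1 (drop i.-1 x))) ->
  multilinear (fun x : (m + n).-tuple B =>
    app f (seg x 1 (i - 1) ++ y x :: seg x (i + n + 1) (m + n))).
Proof.
rewrite mem_index_iota; case: i => // o /andP[_ om] Pphi Py.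
apply: (@multilinear_lin3 _ _ _ _ (fun x =>
  app f (seg x 1 (o.+1 - 1) ++ y x :: seg x (o.+1 + n + 1) (m + n)))).
apply: lin3_on_eq (lin3_on_insert f Pphi om) => s szs; congr app.
rewrite seg1 subn1 Py // drop_drop addn1 seg_end //.
by rewrite addSn [(n.+1 + o)%N]addnC addnS.
Qed.

Lemma insert_fun_multilinear m n p (f : multihom B A m) (g : multihom B A n) :
  p = (m + n)%N -> multilinear (fun x : p.-tuple B => insert_fun f g x).
Proof.
move=> ->; apply: multilinearD; last apply: multilinearN;
  apply: multilinear_sum => i im; apply: multilinearZ.
  pose phi s : B := app g (take n s) ▷ (drop n s)`_0.
  apply: (@insert_multilinear _ _ _ phi
    (fun x => app g (seg x i (i + n - 1)) ▷ ent x (i + n))) => //.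
    rewrite -addn1.
    exact: (lin3_on_bilinear (mp_tr M) (lin3_on_app g) (@lin3_on_head _ _)).
  move: im; rewrite mem_index_iota; case: i => // o _ x.
  rewrite /phi take_takel // nth_drop addn0 nth_take // nth_drop take_drop.
  by rewrite /seg /ent addSn subn1 /= [(n + o)%N]addnC.
pose phi s : B := (take 1 s)`_0 ◁ app g (drop 1 s).
apply: (@insert_multilinear _ _ _ phi
  (fun x => ent x i ◁ app g (seg x (i + 1) (i + n)))) => //.
  rewrite -add1n.
  exact: (lin3_on_bilinear (mp_tl M) (@lin3_on_head _ _) (lin3_on_app g)).
move: im; rewrite mem_index_iota; case: i => // o _ x.
rewrite /phi /seg /ent !nth_take // nth_drop addn0 take_drop drop_drop.
by rewrite addn1 add1n addSnnS [(n.+1 + o)%N]addnC.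
Qed.

Lemma l1_fun_multilinear m (f : multihom B A m) :
  multilinear (fun x : m.+1.-tuple B => l1_fun f x).
Proof.
rewrite -addn1; apply: multilinearD; first apply: multilinearD.
- apply: multilinearZ; apply: (@multilinear_lin3 _ _ _ _
    (fun x => ent x 1 ⇀ app f (seg x 2 (m + 1)))).
  rewrite addnC.
  apply: lin3_on_eq (lin3_on_bilinear (mp_rh M) (@lin3_on_head _ _)
    (lin3_on_app f)).
  by move=> s szs; rewrite nth_take // seg_end.
- apply: (@multilinear_lin3 _ _ _ _
    (fun x => app f (seg x 1 m) ↼ ent x (m + 1))).
  apply: lin3_on_eq (lin3_on_bilinear (mp_lh M) (lin3_on_app f)
    (@lin3_on_head _ _)).
  by move=> s szs; rewrite seg1 /ent addn1 nth_drop addn0.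
apply: multilinear_sum => i im; apply: multilinearZ.
pose phi s : B := (take 1 s)`_0 ·B (drop 1 s)`_0.
have -> : (i + 2 = i + 1 + 1)%N by rewrite -addnA.
apply: (@insert_multilinear _ 1 _ phi
  (fun x => ent x i ·B ent x (i + 1))) => //.
  exact: (lin3_on_bilinear (mp_nu M) (@lin3_on_head _ _) (@lin3_on_head _ _)).
move: im; rewrite mem_index_iota; case: i => // o _ x.
have E j : (j < 2)%N -> (take 2 (drop o x))`_j = x`_(o + j).
  by move=> j2; rewrite nth_take // nth_drop.
by rewrite /phi nth_take // nth_drop !E // /ent addn0 !addn1.
Qed.

Lemma l2_fun_multilinear m n p (f : multihom B A m) (g : multihom B A n) :
  p = (m + n)%N -> multilinear (fun x : p.-tuple B => l2_fun f g x).
Proof.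
have mulP m' n' (f' : multihom B A m') (g' : multihom B A n') :
    multilinear (fun x : (m' + n').-tuple B =>
      app f' (seg x 1 m') ·A app g' (seg x (m' + 1) (m' + n'))).
  apply: (@multilinear_lin3 _ _ _ _
    (fun x => app f' (seg x 1 m') ·A app g' (seg x (m' + 1) (m' + n')))).
  apply: lin3_on_eq
    (lin3_on_bilinear (mp_mu M) (lin3_on_app f') (lin3_on_app g')).
  by move=> s szs; rewrite seg1 addn1 seg_end.
move=> ->; apply: multilinearD; last first.
  by apply/multilinearN/multilinearZ; rewrite addnC.
apply: multilinearD; last exact/multilinearZ/mulP.
apply: multilinearD; last apply: multilinearN; apply: multilinearZ;
  by apply: insert_fun_multilinear => //; rewrite addnC.
Qed.

Definition l1 m (f : multihom B A m) : multihom B A m.+1 :=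
  MultiHom (l1_fun_multilinear f).

Definition l2 m n p (mn : p = (m + n)%N) (f : multihom B A m)
    (g : multihom B A n) : multihom B A p :=
  MultiHom (l2_fun_multilinear f g mn).

Definition cochains (d : int) : lmodType K :=
  match d with
  | Posz n => multihom B A n.+1
  | Negz _ => 'rV[K]_0
  end.

Definition l1_comp (F : dsum cochains) (d : int) : cochains d :=
  match d with
  | Posz n.+1 => l1 (F (Posz n))
  | Posz 0 => 0
  | Negz _ => 0
  end.

Fact l2_degree p (i : 'I_p) : p.+1 = (i.+1 + (p - i.+1).+1)%N.
Proof. by rewrite addnS subnKC. Qed.

(* In degree p, the sum of the brackets of the components of degrees i and j
   with i + j + 1 = p, that is of i + 1 and j + 1 arguments. *)
Definition l2_comp (F G : dsum cochains) (d : int) : cochains d :=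
  match d with
  | Posz p => \sum_(i < p) l2 (l2_degree i) (F (Posz i)) (G (Posz (p - i.+1)))
  | Negz _ => 0
  end.

Lemma l1_comp_fin F : finite_set [set d | l1_comp F d != 0].
Proof.
apply: sub_finite_set (finite_image (fun d => d + 1) (dsum_fin F)).
move=> [[|n]|n] /=; rewrite ?eqxx // => l1n0.
exists (Posz n); last by rewrite -PoszD addn1.
apply: contra_neq l1n0 => F0; apply: multihom_ext => x /=.
have F0' s : app (F (Posz n)) s = 0 by rewrite F0.
rewrite /l1_fun !F0' linear0r linear0l scaler0 !add0r big1 // => i _.
by rewrite F0' scaler0.
Qed.

Lemma l2_fun0 m n (f : multihom B A m) (g : multihom B A n) x :
  f = 0 \/ g = 0 -> l2_fun f g x = 0.
Proof.
have ins0 m' n' (f' : multihom B A m') (g' : multihom B A n') :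
    f' = 0 \/ g' = 0 -> insert_fun f' g' x = 0.
  case=> ->.
    by rewrite /insert_fun !big1 ?subr0 // => i _; rewrite scaler0.
  have term0 i q : i \in index_iota 1 m'.+1 ->
      app f' (seg x 1 (i - 1) ++ 0 :: q) = 0.
    rewrite mem_index_iota; case: i => // o /andP[_]; rewrite ltnS => om.
    apply: app0; rewrite seg1 subn1 (leq_ltn_trans _ om) // size_take.
    by case: ltnP.
  rewrite /insert_fun !big1_seq ?subr0 // => i /= /term0 i0.
    by rewrite linear0r i0 scaler0.
  by rewrite linear0l i0 scaler0.
move=> fg0; rewrite /l2_fun !ins0 //; last by case: fg0; [right|left].
rewrite !scaler0 subr0 add0r.
case: fg0 => ->; first by rewrite linear0l linear0r !scaler0 subr0.
by rewrite linear0l linear0r !scaler0 subr0.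
Qed.

Lemma l2_comp_fin F G : finite_set [set d | l2_comp F G d != 0].
Proof.
apply: sub_finite_set (finite_image (fun ij => ij.1 + ij.2 + 1)
  (finite_setX (dsum_fin F) (dsum_fin G))).
move=> [p|n] /=; rewrite ?eqxx // => sum0.
have /existsP[i Fi] : [exists i : 'I_p,
    l2 (l2_degree i) (F (Posz i)) (G (Posz (p - i.+1))) != 0].
  apply: contraNT sum0 => /existsPn sum0; rewrite big1 // => i _.
  by apply/eqP; move: (sum0 i); rewrite negbK.
exists (Posz i, Posz (p - i.+1)); last first.
  by rewrite /= addrAC -!PoszD addn1 subnKC.
by split=> /=; apply: contra_neq Fi => E; apply: multihom_ext => x /=;
  apply: l2_fun0; [left|right].
Qed.

Definition l1_tot F : dsum cochains := DSum (l1_comp_fin F).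
Definition l2_tot F G : dsum cochains := DSum (l2_comp_fin F G).

Definition cochain_l (k : nat) : k.-tuple (dsum cochains) -> dsum cochains :=
  match k with
  | 1 => fun x => l1_tot (tnth x ord0)
  | 2 => fun x => l2_tot (tnth x ord0) (tnth x ord_max)
  | _ => fun=> 0
  end.

(* A linear map B -> A, seen as a cochain of degree 0. *)
Definition cochain_of_linear (r : {linear B -> A}) : dsum cochains :=
  @dinj K cochains 0 (multihom_of_linear r).

End Cochains.

(* Main.v *)
Require Import Defs.
From HB Require Import structures.
From mathcomp Require Import all_boot all_order all_fingroup all_algebra.
From mathcomp Require Import boolp functions ring zify.

Set Implicit Arguments.
Unset Strict Implicit.
Unset Printing Implicit Defensive.

Import GRing.Theory.
Local Open Scope ring_scope.

(** A cochain of arity m is treated as a function f on all words in B that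
    vanishes on the words of length different from m and is linear in each
    letter.  Three operations generate everything:
    - [cup], the product of two functions along a bilinear map, the first one
      evaluated on a prefix and the second one on the remaining suffix;
    - [ins b beta phi], the signed sum over all ways of replacing b + 1
      consecutive letters of a word by their value under beta before applying
      phi, that is, the transpose of the coderivation defined by beta;
    - [idc], the identity of B seen as a cochain of arity 1.
    Insertions are graded derivations of cup products ([ins_cup]), and two of
    them commute up to the insertion of their graded commutator ([ins_comm]).

    Write 1 for the identity of B, and write the cup products along the four
    actions and the product of A like these operations: |>, <| for the actions
    of A on B, -> and <- for those of B on A.  Let hat f = f |> 1 -
    (-1)^m 1 <| f for f of arity m, let D_f be the insertion of hat f, and let
    L_f phi = D_f phi - f . phi.  Up to the sign (-1)^m
    the binary bracket is c(f, g) = L_g f - (-1)^(m n) L_f g.  Since B is an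
    A-bimodule, the graded commutator of hat f and hat g is hat c(f, g)
    ([ins_hat_hat]); hence [L_g, L_f] = L_c(f, g) ([actL_comm]), so that f o g =
    L_f g behaves as a graded flat and torsion-free connection, and the Jacobi
    identity of the bracket c is the first Bianchi identity
    ([bracket2_jacobi]).

    Up to the sign (-1)^m the unary bracket is delta f = D_nu f - 1 -> f +
    (-1)^m f <- 1, where D_nu inserts the product of B; this is minus the
    Hochschild differential of B with coefficients in A.  Here
    delta^2 = 0 because B is associative and A is a B-bimodule ([dif_dif]).  The
    compatibility of the matched pair on the side of B says that the graded
    commutator of D_nu and D_g is D_(delta g) ([ins_prodB_ins_hat]), and on the
    side of A that delta L_g f - (-1)^n L_g delta f - L_(delta g) f is graded
    symmetric in f and g ([dif_actL]).  This term therefore drops out of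
    delta c(f, g), and delta is a derivation of c ([bracket1_bracket2]).

    It remains to compare these operations with the explicit sums
    ([l1_fun_bracket1], [l2_fun_bracket2]), to pass to the direct sum, and to
    list the shuffles for N <= 3.  The Maurer-Cartan equation of a linear map r
    reads l_1(r) + l_2(r, r) / 2 = 0, whose value on (x, y) is the difference
    of the two sides of the equation of deformation maps. *)

(** * Identities between linear combinations *)

Section LinearCombinations.
Variables (K : comPzRingType) (V : lmodType K).

(** Syntax of the linear combinations of a list of vectors.  Two of them are
    equal as soon as the coefficients of each vector agree ([lc_eq]); this
    reduces identities in a module to identities in the ring of scalars. *)
Inductive lincomb :=
  | LAtom of nat
  | LZero
  | LAdd of lincomb & lincomb
  | LOpp of lincomb
  | LScale of K & lincomb.

Fixpoint lc_eval (env : seq V) e : V :=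
  match e with
  | LAtom i => env`_i
  | LZero => 0
  | LAdd e1 e2 => lc_eval env e1 + lc_eval env e2
  | LOpp e1 => - lc_eval env e1
  | LScale a e1 => a *: lc_eval env e1
  end.

Fixpoint lc_coef (i : nat) e : K :=
  match e with
  | LAtom j => if Nat.eqb i j then 1 else 0
  | LZero => 0
  | LAdd e1 e2 => lc_coef i e1 + lc_coef i e2
  | LOpp e1 => - lc_coef i e1
  | LScale a e1 => a * lc_coef i e1
  end.

(** Equality of the coefficients of index less than n, as a conjunction that
    unfolds to one equation between scalars for each index. *)
Fixpoint lc_same n e1 e2 : Prop :=
  match n with
  | 0 => True
  | n'.+1 => lc_coef n' e1 = lc_coef n' e2 /\ lc_same n' e1 e2
  end.

Lemma lc_evalE env e :
  lc_eval env e = \sum_(i < size env) lc_coef i e *: env`_i.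
Proof.
elim: e => [j||e1 IH1 e2 IH2|e IH|a e IH] /=.
- have [ltj|gej] := ltnP j (size env).
    rewrite (bigD1 (Ordinal ltj)) //= big1 => [|i /eqP neq_ij].
      by rewrite PeanoNat.Nat.eqb_refl scale1r addr0.
    case: (PeanoNat.Nat.eqb_spec i j) => [eq_ij|]; last by rewrite scale0r.
    by case: neq_ij; exact: val_inj.
  rewrite nth_default // big1 // => i _.
  case: (PeanoNat.Nat.eqb_spec i j) => [eq_ij|]; last by rewrite scale0r.
  by move: (ltn_ord i); rewrite eq_ij ltnNge gej.
- by rewrite big1 // => i _; rewrite scale0r.
- by rewrite IH1 IH2 -big_split; apply: eq_bigr => i _; rewrite scalerDl.
- by rewrite IH -sumrN; apply: eq_bigr => i _; rewrite scaleNr.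
- by rewrite IH scaler_sumr; apply: eq_bigr => i _; rewrite scalerA.
Qed.

Lemma lc_eq env e1 e2 :
  lc_same (size env) e1 e2 -> lc_eval env e1 = lc_eval env e2.
Proof.
move=> same; rewrite !lc_evalE.
have {}same i : (i < size env)%N -> lc_coef i e1 = lc_coef i e2.
  elim: (size env) same => // n IHn /= [eqn /IHn same]; rewrite ltnS leq_eqVlt.
  by case/predU1P => [->|/same].
by apply: eq_bigr => i _; rewrite same.
Qed.

End LinearCombinations.

(* The maximal subterms that are not sums, opposites or multiples are the
   vectors listed in env. *)
Ltac lc_index x env :=
  lazymatch env with
  | x :: _ => constr:(0%N)
  | _ :: ?env' => let i := lc_index x env' in constr:(S i)
  end.

Ltac lc_insert x env :=
  lazymatch env with
  | nil => constr:([:: x])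
  | x :: _ => env
  | ?y :: ?env' => let r := lc_insert x env' in constr:(y :: r)
  end.

Ltac lc_atoms env e :=
  lazymatch e with
  | @GRing.zero _ => env
  | @GRing.add _ ?x ?y => let env' := lc_atoms env x in lc_atoms env' y
  | @GRing.opp _ ?x => lc_atoms env x
  | @GRing.scale _ _ ?a ?x => lc_atoms env x
  | _ => lc_insert e env
  end.

Ltac lc_reify K env e :=
  lazymatch e with
  | @GRing.zero _ => constr:(@LZero K)
  | @GRing.add _ ?x ?y =>
      let x' := lc_reify K env x in let y' := lc_reify K env y in
      constr:(@LAdd K x' y')
  | @GRing.opp _ ?x => let x' := lc_reify K env x in constr:(@LOpp K x')
  | @GRing.scale _ _ ?a ?x =>
      let x' := lc_reify K env x in constr:(@LScale K a x')
  | _ => let i := lc_index e env in constr:(@LAtom K i)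
  end.

(* Replaces an equality between linear combinations by the equalities between
   their coefficients. *)
Ltac lincomb_coefs K :=
  lazymatch goal with
  | |- @eq ?V ?x ?y =>
      let env := lc_atoms (@nil V) x in
      let env := lc_atoms env y in
      let x' := lc_reify K env x in
      let y' := lc_reify K env y in
      change (lc_eval env x' = lc_eval env y');
      apply: lc_eq; cbn [lc_same size lc_coef Nat.eqb]
  end.

Lemma signr_sq (K : pzRingType) n : (-1) ^+ n * (-1) ^+ n = 1 :> K.
Proof. by rewrite -exprD addnn -signr_odd odd_double. Qed.

(* Generalizes the sign (-1) ^+ n to a variable e of square 1. *)
Ltac set_sign K n e sq_e :=
  move: (signr_sq K n); move: ((-1 : K) ^+ n) => e sq_e.

Lemma linear_map0 (K : pzRingType) (V W : lmodType K) (h : V -> W) :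
  (forall a u v, h (a *: u + v) = a *: h u + h v) -> h 0 = 0.
Proof. by move=> /(_ (-1) 0 0); rewrite scaler0 addr0 scaleN1r addNr. Qed.

(** * Functions on words and insertions *)

Section Pointwise.
Variables (K : pzRingType) (T : Type) (V : lmodType K).
Implicit Types (f g : T -> V) (x : T).

Lemma fctDE f g x : (f + g) x = f x + g x. Proof. by []. Qed.
Lemma fctNE f x : (- f) x = - f x. Proof. by []. Qed.
Lemma fctZE a f x : (a *: f) x = a *: f x. Proof. by []. Qed.

End Pointwise.

Section Insertion.
Variables (K : fieldType) (U : lmodType K).

(** f vanishes on the words of length different from n. *)
Definition supported (V : lmodType K) (n : nat) (f : seq U -> V) :=
  forall s, size s != n -> f s = 0.

(** f is linear in each letter, on words of every length; together with
    [supported n f] this says that f is an n-linear map. *)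
Definition slotwise_linear (V : lmodType K) (f : seq U -> V) :=
  forall p q a u v,
    f (p ++ (a *: u + v) :: q) = a *: f (p ++ u :: q) + f (p ++ v :: q).

(** The sum, over the positions i of the word s, of (-1) ^ (i b) times phi
    applied to s with the b + 1 letters starting at position i replaced by their
    value under beta.  Near the end of s fewer than b + 1 letters remain; those
    terms vanish when beta is supported in length b + 1 and phi is linear. *)
Fixpoint ins (V : lmodType K) (b : nat) (beta : seq U -> U)
    (phi : seq U -> V) (s : seq U) : V :=
  if s is x :: s' then
    phi (beta (take b.+1 s) :: drop b.+1 s)
    + (-1) ^+ b *: ins b beta (fun t => phi (x :: t)) s'
  else 0.

Lemma ins_cons (V : lmodType K) b beta (phi : seq U -> V) x s :
  ins b beta phi (x :: s) =
  phi (beta (take b.+1 (x :: s)) :: drop b.+1 (x :: s))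
  + (-1) ^+ b *: ins b beta (fun t => phi (x :: t)) s.
Proof. by []. Qed.

Lemma slotwise_linear_shift (V : lmodType K) (f : seq U -> V) x :
  slotwise_linear f -> slotwise_linear (fun t => f (x :: t)).
Proof. by move=> lf p q; exact: (lf (x :: p) q). Qed.

Lemma slotwise_linear0 (V : lmodType K) (f : seq U -> V) p q :
  slotwise_linear f -> f (p ++ 0 :: q) = 0.
Proof.
by move=> lf; apply: (@linear_map0 _ _ _ (fun u => f (p ++ u :: q))) => a u v.
Qed.

Lemma supported_shift (V : lmodType K) n (f : seq U -> V) x :
  supported n.+1 f -> supported n (fun t => f (x :: t)).
Proof. by move=> sf s sz; apply: sf; rewrite eqSS. Qed.

Section Target.
Variable V : lmodType K.
Implicit Types (phi psi : seq U -> V) (beta : seq U -> U) (b : nat).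

Lemma ins0 b beta s : ins b beta (fun=> 0 : V) s = 0.
Proof. by elim: s => //= x s ->; rewrite scaler0 addr0. Qed.

Lemma insDr b beta phi psi :
  ins b beta (phi + psi) = ins b beta phi + ins b beta psi.
Proof.
apply/funext => s; rewrite ?fctDE ?fctZE.
elim: s phi psi => [|x s IHs] phi psi /=.
  by rewrite addr0.
rewrite (IHs (fun t => phi (x :: t)) (fun t => psi (x :: t))) /=.
by rewrite scalerDr addrACA.
Qed.

Lemma insZr b beta a phi : ins b beta (a *: phi) = a *: ins b beta phi.
Proof.
apply/funext => s; rewrite ?fctDE ?fctZE; elim: s phi => [|x s IHs] phi /=.
  by rewrite scaler0.
rewrite (IHs (fun t => phi (x :: t))) /= scalerDr !scalerA.
by rewrite [a * _]mulrC.
Qed.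

Lemma insNr b beta phi : ins b beta (- phi) = - ins b beta phi.
Proof. by rewrite -scaleN1r insZr scaleN1r. Qed.

Lemma insZl b beta a phi :
  slotwise_linear phi -> ins b (a *: beta) phi = a *: ins b beta phi.
Proof.
move=> lphi; apply/funext => s; rewrite ?fctDE ?fctZE.
elim: s phi lphi => [|x s IHs] phi lphi /=.
  by rewrite scaler0.
rewrite (IHs _ (slotwise_linear_shift x lphi)) /= scalerDr !scalerA.
have := lphi [::] (drop b s) a (beta (take b.+1 (x :: s))) 0.
rewrite addr0 /= => ->; rewrite (slotwise_linear0 [::] _ lphi) addr0.
by rewrite [_ * a]mulrC.
Qed.

Lemma insDl b beta beta' phi :
  slotwise_linear phi ->
  ins b (beta + beta') phi = ins b beta phi + ins b beta' phi.
Proof.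
move=> lphi; apply/funext => s; rewrite ?fctDE ?fctZE.
elim: s phi lphi => [|x s IHs] phi lphi /=.
  by rewrite addr0.
rewrite (IHs _ (slotwise_linear_shift x lphi)) /= scalerDr addrACA.
congr (_ + _).
have := lphi [::] (drop b s) 1 (beta (take b.+1 (x :: s)))
  (beta' (take b.+1 (x :: s))).
by rewrite !scale1r /= => ->.
Qed.

Lemma ins_supported0 b beta phi : supported 0 phi -> ins b beta phi = 0.
Proof.
move=> sphi; apply/funext => -[|x s] //=; rewrite sphi // add0r.
rewrite (_ : (fun t => _) = fun=> 0) ?ins0 ?scaler0 //.
by apply/funext => t; rewrite sphi.
Qed.

Lemma ins_supported n b beta phi :
  supported b.+1 beta -> supported n phi -> slotwise_linear phi ->
  supported (n + b) (ins b beta phi).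
Proof.
move=> sbeta sphi lphi s.
elim: s n phi sphi lphi => [|x s IHs] [|n] phi sphi lphi.
- by [].
- by [].
- by rewrite ins_supported0.
rewrite addSn eqSS => szs; rewrite [LHS]/=.
rewrite (IHs n _ (supported_shift x sphi) (slotwise_linear_shift x lphi) szs).
rewrite scaler0 addr0; have [leb|ltb] := leqP b (size s).
  apply: sphi; rewrite /= size_drop eqSS; apply: contra szs => /eqP <-.
  by rewrite subnK.
rewrite sbeta ?(slotwise_linear0 [::] _ lphi) //.
by rewrite /= eqSS size_take ltnNge (ltnW ltb) /= neq_ltn ltb.
Qed.

End Target.

(** An insertion into a word split after m letters happens either before or
    after the cut, and in the latter case it passes over the m letters. *)
Lemma ins_split (V W : lmodType K) b beta m (f : seq U -> V)
    (P : V -> seq U -> W) s :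
  supported m f -> (forall a u v t, P (a *: u + v) t = a *: P u t + P v t) ->
  ins b beta (fun t => P (f (take m t)) (drop m t)) s =
  P (ins b beta f (take (m + b) s)) (drop (m + b) s)
  + (-1) ^+ (m * b) *: ins b beta (P (f (take m s))) (drop m s).
Proof.
move=> + lP.
have P0 t : P 0 t = 0.
  by apply: (@linear_map0 _ _ _ (P^~ t)) => a u v; exact: lP.
have PD u v t : P (u + v) t = P u t + P v t.
  by have := lP 1 u v t; rewrite /= !scale1r.
have PZ a u t : P (a *: u) t = a *: P u t.
  by have := lP a u 0 t; rewrite /= !addr0 P0 addr0.
elim: m s f => [|m IHm] s f sf.
  rewrite (ins_supported0 _ _ sf) P0 add0r scale1r drop0.
  congr (ins _ _ _ _); apply/funext => t.
  by rewrite !take0 drop0.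
case: s => [|x s]; first by rewrite /= P0 scaler0 addr0.
rewrite [LHS]/= (IHm s _ (supported_shift x sf)) addSn /= PD PZ !scalerDr.
rewrite !scalerA -exprD addrA mulSn; congr (_ + _ + _).
have -> : take b (take (m + b) s) = take b s by rewrite take_takel ?leq_addl.
by rewrite -!take_drop drop_drop.
Qed.

(** The terms in which alpha and beta are inserted at disjoint places cancel; in
    the others one of them is inserted into the other one. *)
Lemma ins_comm (V : lmodType K) a b (alpha beta : seq U -> U)
    (phi : seq U -> V) :
  supported a.+1 alpha -> supported b.+1 beta -> slotwise_linear phi ->
  ins b beta (ins a alpha phi) - (-1) ^+ (a * b) *: ins a alpha (ins b beta phi)
  = ins (a + b) (ins b beta alpha - (-1) ^+ (a * b) *: ins a alpha beta) phi.
Proof.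
have insE c d (gamma delta : seq U -> U) (psi : seq U -> V) x s :
    supported c.+1 gamma -> slotwise_linear psi ->
    ins d delta (ins c gamma psi) (x :: s) =
    psi (ins d delta gamma (take (c + d).+1 (x :: s))
         :: drop (c + d).+1 (x :: s))
    + (-1) ^+ (c.+1 * d) *:
        ins d delta (fun t => psi (gamma (take c.+1 (x :: s)) :: t)) (drop c s)
    + (-1) ^+ c *:
        ins c gamma (fun t => psi (delta (take d.+1 (x :: s)) :: t)) (drop d s)
    + (-1) ^+ (c + d) *:
        ins d delta (ins c gamma (fun t => psi (x :: t))) s.
  (* the first insertion starts at the first letter (psi1) or later (psi2) *)
  move=> sgamma lpsi.
  pose psi1 t := psi (gamma (take c.+1 t) :: drop c.+1 t).
  pose psi2 t := (-1) ^+ c *: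
    if t is y :: t' then ins c gamma (fun q => psi (y :: q)) t' else 0.
  have -> : ins c gamma psi = psi1 + psi2.
    apply/funext => -[|y t] //.
    rewrite fctDE /psi1 /psi2 /= sgamma // (slotwise_linear0 [::] _ lpsi).
    by rewrite scaler0 addr0.
  rewrite insDr fctDE {1}/psi1.
  rewrite (ins_split _ _ (P := fun v t => psi (v :: t))) //; last first.
    by move=> c' u v t; exact: (lpsi [::] t).
  rewrite addSn /= -!addrA; congr (_ + (_ + _)).
  rewrite [X in ins _ _ X](_ : _ =
    (-1) ^+ c *: ins c gamma (fun t => psi (x :: t))).
    by rewrite insZr fctZE scalerA exprD [_ * (-1) ^+ c]mulrC.
  by apply/funext => t; rewrite /psi2.
move=> salpha sbeta lphi; apply/funext => s; rewrite fctDE fctNE fctZE.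
elim: s phi lphi => [|x s IHs] phi lphi; first by rewrite scaler0 subr0.
rewrite (insE a b) // (insE b a) // [in RHS]ins_cons.
rewrite -(IHs _ (slotwise_linear_shift x lphi)) [(b + a)%N]addnC.
have lphiB c u v t : phi ((u - c *: v) :: t) = phi (u :: t) - c *: phi (v :: t).
  have /= := lphi [::] t (- c) v u; rewrite scaleNr addrC => ->.
  by rewrite scaleNr addrC.
rewrite fctDE fctNE fctZE lphiB.
set A1 := phi _; set A2 := phi _; set A3 := ins _ _ _ _; set A4 := ins _ _ _ _.
set A5 := ins _ _ _ _; set A6 := ins _ _ _ _.
rewrite mulSn [(b.+1 * a)%N]mulSn [(b * a)%N]mulnC !exprD.
set_sign K a ea sq_a; set_sign K b eb sq_b; set_sign K (a * b)%N eab sq_ab.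
by lincomb_coefs K; repeat split; ring: sq_a sq_b sq_ab.
Qed.

End Insertion.

(** * Cup products *)

Section Cup.
Variables (K : fieldType) (U : lmodType K).

Lemma ins_comp_linear (V W : lmodType K) b (beta : seq U -> U)
    (h : {linear V -> W}) (phi : seq U -> V) s :
  ins b beta (h \o phi) s = h (ins b beta phi s).
Proof.
elim: s phi => [|x s IHs] phi; first by rewrite /= linear0.
by rewrite !ins_cons linearD linearZ -(IHs (fun t => phi (x :: t))).
Qed.

(** The identity of U as a cochain of arity 1. *)
Definition idc (s : seq U) : U := if s is [:: x] then x else 0.

Lemma idc_supported : supported 1 idc.
Proof. by case=> [|x [|y s]] /=. Qed.

Lemma ins_idc b (beta : seq U -> U) :
  supported b.+1 beta -> ins b beta idc = beta.
Proof.
move=> sbeta; apply/funext => -[|x s]; first by rewrite sbeta.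
rewrite ins_cons ins_supported0 ?scaler0 ?addr0; last by case.
rewrite -[drop _ _]/(drop b s); have [leb|ltb] := leqP (size s) b.
  by rewrite drop_oversize // take_oversize.
rewrite (sbeta (x :: s)) ?eqSS ?neq_ltn ?ltb ?orbT //.
have : (0 < size (drop b s))%N by rewrite size_drop subn_gt0.
by case: (drop b s).
Qed.

Section Bilinear.
Variables (V W Z : lmodType K) (B : {bilinear V -> W -> Z}).
Implicit Types (f : seq U -> V) (g : seq U -> W).

(** The product of f and g along B, where f is applied to the first m letters
    and g to the remaining ones. *)
Definition cup (m : nat) f g (s : seq U) : Z := B (f (take m s)) (g (drop m s)).

Lemma cupDl m f f' g : cup m (f + f') g = cup m f g + cup m f' g.
Proof. by apply/funext => s; rewrite fctDE /cup linearDl. Qed.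

Lemma cupDr m f g g' : cup m f (g + g') = cup m f g + cup m f g'.
Proof. by apply/funext => s; rewrite fctDE /cup linearDr. Qed.

Lemma cupZl m a f g : cup m (a *: f) g = a *: cup m f g.
Proof. by apply/funext => s; rewrite fctZE /cup linearZl_LR. Qed.

Lemma cupZr m a f g : cup m f (a *: g) = a *: cup m f g.
Proof. by apply/funext => s; rewrite fctZE /cup linearZr_LR. Qed.

Lemma cupNl m f g : cup m (- f) g = - cup m f g.
Proof. by apply/funext => s; rewrite fctNE /cup linearNl. Qed.

Lemma cupNr m f g : cup m f (- g) = - cup m f g.
Proof. by apply/funext => s; rewrite fctNE /cup linearNr. Qed.

Lemma cup_supported m n f g :
  supported m f -> supported n g -> supported (m + n) (cup m f g).
Proof.
move=> sf sg s szs; rewrite /cup.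
have [szm|szm] := eqVneq (size (take m s)) m; last by rewrite sf // linear0l.
rewrite sg ?linear0r // size_drop; apply: contra szs => /eqP <-.
by rewrite subnKC // -{1}szm size_take_min geq_minr.
Qed.

(** Graded Leibniz rule. *)
Lemma ins_cup b beta m f g :
  supported m f ->
  ins b beta (cup m f g) =
  cup (m + b) (ins b beta f) g + (-1) ^+ (m * b) *: cup m f (ins b beta g).
Proof.
move=> sf; apply/funext => s; rewrite fctDE fctZE.
rewrite (ins_split b beta (P := fun v t => B v (g t))) // => [|a u v t].
  congr (_ + _ *: _); rewrite /cup.
  exact: (ins_comp_linear b beta (B (f (take m s))) g).
by rewrite linearDl linearZl_LR.
Qed.

End Bilinear.

Lemma cup_cupl (V1 V2 V3 V W : lmodType K) (B1 : {bilinear V -> V3 -> W})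
    (B2 : {bilinear V1 -> V2 -> V}) m n f g h s :
  cup B1 (m + n) (cup B2 m f g) h s =
  B1 (B2 (f (take m s)) (g (take n (drop m s)))) (h (drop (m + n) s)).
Proof.
rewrite /cup [in drop m _]addnC -take_drop.
by rewrite take_takel ?leq_addr.
Qed.

Lemma cup_cupr (V1 V2 V3 V W : lmodType K) (B1 : {bilinear V1 -> V -> W})
    (B2 : {bilinear V2 -> V3 -> V}) m n f g h s :
  cup B1 m f (cup B2 n g h) s =
  B1 (f (take m s)) (B2 (g (take n (drop m s))) (h (drop (m + n) s))).
Proof. by rewrite /cup drop_drop addnC. Qed.

End Cup.

(** * Consequences of the axioms of a matched pair *)

Section MatchedPair.
Variables (K : fieldType) (A B : lmodType K) (M : matched_pair A B).
Local Notation mu := (amul (mp_mu M)).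
Local Notation nu := (amul (mp_nu M)).
Local Notation tr := (mp_tr M).
Local Notation tl := (mp_tl M).
Local Notation rh := (mp_rh M).
Local Notation lh := (mp_lh M).

(* The six compatibility conditions are the components of the associativity of
   the product on A + B at triples of elements of A and B that mix both. *)
Lemma mp_tr_nu a x y : tr a (nu x y) = nu (tr a x) y + tr (lh a x) y.
Proof.
have := mp_bowtieA M (a, 0) (0, x) (0, y) => /(congr1 snd) /=.
by rewrite !(linear0l, linear0r, addr0, add0r).
Qed.

Lemma mp_nu_tl x y a : tl (nu x y) a = nu x (tl y a) + tl x (rh y a).
Proof.
have := mp_bowtieA M (0, x) (0, y) (a, 0) => /(congr1 snd) /=.
by rewrite !(linear0l, linear0r, addr0, add0r) => ->.
Qed.

Lemma mp_tl_nu x a y :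
  nu (tl x a) y + tr (rh x a) y = nu x (tr a y) + tl x (lh a y).
Proof.
have := mp_bowtieA M (0, x) (a, 0) (0, y) => /(congr1 snd) /=.
by rewrite !(linear0l, linear0r, addr0, add0r) => ->.
Qed.

Lemma mp_rh_mu x a b : rh x (mu a b) = mu (rh x a) b + rh (tl x a) b.
Proof.
have := mp_bowtieA M (0, x) (a, 0) (b, 0) => /(congr1 fst) /=.
by rewrite !(linear0l, linear0r, addr0, add0r).
Qed.

Lemma mp_mu_lh a b x : lh (mu a b) x = mu a (lh b x) + lh a (tr b x).
Proof.
have := mp_bowtieA M (a, 0) (b, 0) (0, x) => /(congr1 fst) /=.
by rewrite !(linear0l, linear0r, addr0, add0r) => ->.
Qed.

Lemma mp_lh_mu a x b :
  mu (lh a x) b + rh (tr a x) b = mu a (rh x b) + lh a (tl x b).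
Proof.
have := mp_bowtieA M (a, 0) (0, x) (b, 0) => /(congr1 fst) /=.
by rewrite !(linear0l, linear0r, addr0, add0r) => ->.
Qed.

End MatchedPair.

Section CupIdentities.
Variables (K : fieldType) (A B : lmodType K) (M : matched_pair A B).
Local Notation mu := (amul (mp_mu M)).
Local Notation nu := (amul (mp_nu M)).
Local Notation tr := (mp_tr M).
Local Notation tl := (mp_tl M).
Local Notation rh := (mp_rh M).
Local Notation lh := (mp_lh M).
Implicit Types (m n k : nat) (f g h : seq B -> A) (x y z : seq B -> B).

Lemma cup_muA m n k f g h : k = (m + n)%N ->
  cup mu m f (cup mu n g h) = cup mu k (cup mu m f g) h.
Proof.
by move=> ->; apply/funext => s; rewrite cup_cupl cup_cupr amulA.
Qed.

Lemma cup_nuA m n k x y z : k = (m + n)%N ->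
  cup nu m x (cup nu n y z) = cup nu k (cup nu m x y) z.
Proof.
by move=> ->; apply/funext => s; rewrite cup_cupl cup_cupr amulA.
Qed.

Lemma cup_tr_tr m n k f g x : k = (m + n)%N ->
  cup tr m f (cup tr n g x) = cup tr k (cup mu m f g) x.
Proof.
move=> ->; apply/funext => s; rewrite cup_cupl cup_cupr.
by rewrite (bimod_left (mp_bimodB M)).
Qed.

Lemma cup_tl_tl m n k x f g : k = (m + n)%N ->
  cup tl k (cup tl m x f) g = cup tl m x (cup mu n f g).
Proof.
move=> ->; apply/funext => s; rewrite cup_cupl cup_cupr.
by rewrite (bimod_right (mp_bimodB M)).
Qed.

Lemma cup_tl_tr m n k f x g : k = (m + n)%N ->
  cup tl k (cup tr m f x) g = cup tr m f (cup tl n x g).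
Proof.
move=> ->; apply/funext => s; rewrite cup_cupl cup_cupr.
by rewrite (bimod_mid (mp_bimodB M)).
Qed.

Lemma cup_rh_rh m n k x y f : k = (m + n)%N ->
  cup rh m x (cup rh n y f) = cup rh k (cup nu m x y) f.
Proof.
move=> ->; apply/funext => s; rewrite cup_cupl cup_cupr.
by rewrite (bimod_left (mp_bimodA M)).
Qed.

Lemma cup_lh_lh m n k f x y : k = (m + n)%N ->
  cup lh k (cup lh m f x) y = cup lh m f (cup nu n x y).
Proof.
move=> ->; apply/funext => s; rewrite cup_cupl cup_cupr.
by rewrite (bimod_right (mp_bimodA M)).
Qed.

Lemma cup_lh_rh m n k x f y : k = (m + n)%N ->
  cup lh k (cup rh m x f) y = cup rh m x (cup lh n f y).
Proof.
move=> ->; apply/funext => s; rewrite cup_cupl cup_cupr.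
by rewrite (bimod_mid (mp_bimodA M)).
Qed.

Lemma cup_tr_nu m n k f x y : k = (m + n)%N ->
  cup tr m f (cup nu n x y) =
  cup nu k (cup tr m f x) y + cup tr k (cup lh m f x) y.
Proof.
move=> ->; apply/funext => s; rewrite fctDE !cup_cupl cup_cupr.
by rewrite mp_tr_nu.
Qed.

Lemma cup_nu_tl m n k x y f : k = (m + n)%N ->
  cup tl k (cup nu m x y) f =
  cup nu m x (cup tl n y f) + cup tl m x (cup rh n y f).
Proof.
move=> ->; apply/funext => s; rewrite fctDE cup_cupl !cup_cupr.
by rewrite mp_nu_tl.
Qed.

Lemma cup_tl_nu m n k x f y : k = (m + n)%N ->
  cup nu k (cup tl m x f) y =
  cup nu m x (cup tr n f y) + cup tl m x (cup lh n f y)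
  - cup tr k (cup rh m x f) y.
Proof.
move=> ->; apply/funext => s; rewrite !fctDE fctNE !cup_cupl !cup_cupr.
by rewrite -mp_tl_nu addrK.
Qed.

Lemma cup_rh_mu m n k x f g : k = (m + n)%N ->
  cup rh m x (cup mu n f g) =
  cup mu k (cup rh m x f) g + cup rh k (cup tl m x f) g.
Proof.
move=> ->; apply/funext => s; rewrite fctDE !cup_cupl cup_cupr.
by rewrite mp_rh_mu.
Qed.

Lemma cup_mu_lh m n k f g x : k = (m + n)%N ->
  cup lh k (cup mu m f g) x =
  cup mu m f (cup lh n g x) + cup lh m f (cup tr n g x).
Proof.
move=> ->; apply/funext => s; rewrite fctDE cup_cupl !cup_cupr.
by rewrite mp_mu_lh.
Qed.

Lemma cup_lh_mu m n k f x g : k = (m + n)%N ->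
  cup mu k (cup lh m f x) g =
  cup mu m f (cup rh n x g) + cup lh m f (cup tl n x g)
  - cup rh k (cup tr m f x) g.
Proof.
move=> ->; apply/funext => s; rewrite !fctDE fctNE !cup_cupl !cup_cupr.
by rewrite -mp_lh_mu addrK.
Qed.

End CupIdentities.

(** * The operators of the two brackets *)

Section Operators.
Variables (K : fieldType) (A B : lmodType K) (M : matched_pair A B).
Local Notation mu := (amul (mp_mu M)).
Local Notation nu := (amul (mp_nu M)).
Local Notation tr := (mp_tr M).
Local Notation tl := (mp_tl M).
Local Notation rh := (mp_rh M).
Local Notation lh := (mp_lh M).
Local Notation idc := (@idc K B).
Implicit Types (m n k : nat) (f g h : seq B -> A).

(** The (m + 1)-ary map f |> 1 - (-1)^m 1 <| f on B defined by f. *)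
Definition hat m f : seq B -> B :=
  cup tr m f idc - (-1) ^+ m *: cup tl 1 idc f.

(** The operator L_f on cochains. *)
Definition actL m f (phi : seq B -> A) : seq B -> A :=
  ins m (hat m f) phi - cup mu m f phi.

(** The bracket c(f, g) = L_g f - (-1)^(m n) L_f g. *)
Definition bra m n f g : seq B -> A :=
  actL n g f - (-1) ^+ (m * n) *: actL m f g.

(** The product of B as a cochain of arity 2. *)
Definition prodB : seq B -> B := cup nu 1 idc idc.

(** Minus the Hochschild differential of f, for B acting on A. *)
Definition dif m f : seq B -> A :=
  ins 1 prodB f - cup rh 1 idc f + (-1) ^+ m *: cup lh m f idc.

Lemma supportedD (V : lmodType K) n (f g : seq B -> V) :
  supported n f -> supported n g -> supported n (f + g).
Proof. by move=> sf sg s szs; rewrite fctDE sf // sg // addr0. Qed.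

Lemma supportedZ (V : lmodType K) n a (f : seq B -> V) :
  supported n f -> supported n (a *: f).
Proof. by move=> sf s szs; rewrite fctZE sf // scaler0. Qed.

Lemma supportedN (V : lmodType K) n (f : seq B -> V) :
  supported n f -> supported n (- f).
Proof. by move=> sf s szs; rewrite fctNE sf // oppr0. Qed.

Lemma hat_supported m f : supported m f -> supported m.+1 (hat m f).
Proof.
move=> sf; apply: supportedD; last apply/supportedN/supportedZ.
  by rewrite -addn1; apply: cup_supported => //; exact: idc_supported.
by rewrite -add1n; apply: cup_supported => //; exact: idc_supported.
Qed.

Lemma prodB_supported : supported 2 prodB.
Proof. by apply: (@cup_supported _ _ _ _ _ _ 1 1); exact: idc_supported. Qed.

Definition cupLin := (cupDl, cupDr, cupNl, cupNr, cupZl, cupZr).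
Definition insLin := (insDr, insNr, insZr).

(** f |-> hat f turns the bracket c into the graded commutator of insertions. *)
Lemma ins_hat_hat m n f g : supported m f -> supported n g ->
  ins n (hat n g) (hat m f) - (-1) ^+ (m * n) *: ins m (hat m f) (hat n g)
  = hat (m + n) (bra m n f g).
Proof.
have insE k l (f' g' : seq B -> A) : supported k f' -> supported l g' ->
    ins l (hat l g') (hat k f') =
    cup tr (k + l) (ins l (hat l g') f') idc
    + (-1) ^+ (k * l) *: cup tr k f' (hat l g')
    - (-1) ^+ k *: (cup tl l.+1 (hat l g') f'
      + (-1) ^+ l *: cup tl 1 idc (ins l (hat l g') f')).
  move=> sf sg; rewrite {2}/hat !insLin ins_cup //.
  rewrite (ins_cup _ _ _ _ (@idc_supported K B)).
  by rewrite mul1n add1n ins_idc //; exact: hat_supported.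
move=> sf sg; rewrite !insE // [in RHS]/hat /bra /actL.
set Dgf := ins n _ f; set Dfg := ins m _ g.
rewrite /hat !cupLin.
rewrite !(cup_tr_tr M _ _ _ (erefl (_ + _)%N)).
rewrite (@cup_tl_tr _ _ _ M n 1) ?addn1 // (@cup_tl_tr _ _ _ M m 1) ?addn1 //.
rewrite (@cup_tl_tl _ _ _ M 1 n) // (@cup_tl_tl _ _ _ M 1 m) //.
rewrite [(n + m)%N]addnC [(n * m)%N]mulnC !exprD.
set_sign K m em sq_m; set_sign K n en sq_n; set_sign K (m * n)%N emn sq_mn.
by lincomb_coefs K; repeat split; ring: sq_m sq_n sq_mn.
Qed.

(** The analogue of [ins_hat_hat] for the product of B, in which the
    compatibility conditions with values in B enter. *)
Lemma ins_prodB_hat n g : supported n g ->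
  ins 1 prodB (hat n g) - (-1) ^+ n *: ins n (hat n g) prodB
  = hat n.+1 (dif n g).
Proof.
move=> sg; have sidc := @idc_supported K B.
rewrite {1}/hat !insLin ins_cup // (ins_cup _ _ _ _ sidc).
rewrite ins_idc; last exact: prodB_supported.
rewrite {2}/prodB (ins_cup _ _ _ _ sidc) ins_idc; last exact: hat_supported.
rewrite [in RHS]/hat /dif.
set Dg := ins 1 prodB g.
rewrite /hat /prodB !cupLin !(muln1, mul1n, addn1, add1n).
rewrite (@cup_tr_nu _ _ _ M n 1 n.+1) ?addn1 //.
rewrite (@cup_nu_tl _ _ _ M 1 1) // (@cup_tl_nu _ _ _ M 1 n) //.
rewrite !exprS.
set_sign K n en sq_n.
by lincomb_coefs K; repeat split; ring: sq_n.
Qed.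

(** L is a representation of the bracket c. *)
Lemma actL_comm m n f g phi :
  supported m f -> supported n g -> slotwise_linear phi ->
  actL n g (actL m f phi) - (-1) ^+ (m * n) *: actL m f (actL n g phi)
  = actL (m + n) (bra m n f g) phi.
Proof.
move=> sf sg lphi; rewrite [in RHS]/actL -ins_hat_hat //.
rewrite -ins_comm //; try exact: hat_supported.
rewrite /actL !insLin !(ins_cup (mp_mu M)) // /bra /actL !cupLin.
rewrite !(cup_muA M _ _ _ (erefl (_ + _)%N)) [(n + m)%N]addnC [(n * m)%N]mulnC.
set_sign K (m * n)%N emn sq_mn.
by lincomb_coefs K; repeat split; ring: sq_mn.
Qed.

Lemma ins_prodB_ins_hat n f g : supported n g -> slotwise_linear f ->
  ins 1 prodB (ins n (hat n g) f) - (-1) ^+ n *: ins n (hat n g) (ins 1 prodB f)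
  = ins n.+1 (hat n.+1 (dif n g)) f.
Proof.
move=> sg lf; rewrite -ins_prodB_hat // -[n.+1]addn1.
have := ins_comm (hat_supported sg) prodB_supported lf.
by rewrite muln1.
Qed.

(** The obstruction to the compatibility of delta with L; it is graded symmetric
    in f and g. *)
Definition defect m n f g : seq B -> A :=
  cup lh n g (hat m f) + (-1) ^+ (m * n) *: cup lh m f (hat n g).

(** The compatibility conditions with values in A say that delta and L commute up
    to the defect, which is symmetric and does not contribute to the bracket. *)
Lemma dif_actL m n f g :
  supported m f -> supported n g -> slotwise_linear f ->
  dif (m + n) (actL n g f) =
  (-1) ^+ n *: actL n g (dif m f) + actL n.+1 (dif n g) f
  - (-1) ^+ (m + n) *: defect m n f g.
Proof.
move=> sf sg lf; have sidc := @idc_supported K B.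
rewrite /actL -ins_prodB_ins_hat // /dif !insLin.
rewrite !ins_cup // ins_idc; last exact: hat_supported.
rewrite /defect !cupLin.
set DDf := ins 1 prodB (ins n _ f). set DDf' := ins n _ (ins 1 _ f).
set Df := ins 1 _ f; set Dgf := ins n _ f.
rewrite /hat ?cupLin !(muln1, mul1n, addn1, add1n).
rewrite (@cup_rh_mu _ _ _ M 1 n n.+1) // (@cup_mu_lh _ _ _ M n m) 1?addnC //.
rewrite (@cup_lh_mu _ _ _ M n 1) ?addn1 //.
rewrite !exprD.
set_sign K m em sq_m; set_sign K n en sq_n; set_sign K (m * n)%N emn sq_mn.
by lincomb_coefs K; repeat split; ring: sq_m sq_n sq_mn.
Qed.

Lemma ins0l (V : lmodType K) b (phi : seq B -> V) :
  slotwise_linear phi -> ins b 0 phi = 0.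
Proof. by move=> lphi; rewrite -(scale0r 0) insZl // scale0r. Qed.

Lemma ins_prodB_prodB : ins 1 prodB prodB = 0.
Proof.
have sidc := @idc_supported K B.
rewrite {2}/prodB (ins_cup _ _ _ _ sidc) ins_idc; last exact: prodB_supported.
rewrite /prodB muln1 expr1 (@cup_nuA _ _ _ M 1 1 2) // scaleN1r.
exact: subrr.
Qed.

(** Twice the square of the insertion of the product of B is the insertion of
    the associator, which vanishes; dividing by 2 uses the characteristic. *)
Lemma dif_dif m f : 2%:R != 0 :> K ->
  supported m f -> slotwise_linear f -> dif m.+1 (dif m f) = 0.
Proof.
move=> nz2 sf lf; have sidc := @idc_supported K B.
have DD0 : ins 1 prodB (ins 1 prodB f) = 0.
  have := ins_comm prodB_supported prodB_supported lf.
  rewrite ins_prodB_prodB scaler0 subr0 ins0l // scaleN1r opprK => DD.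
  by apply: (scalerI nz2); rewrite scaler0 scaler_nat mulr2n.
rewrite /dif !insLin DD0 (ins_cup (mp_rh M) _ _ _ sidc) (ins_cup (mp_lh M)) //.
rewrite ins_idc; last exact: prodB_supported.
rewrite !cupLin {1 4}/prodB.
set Df := ins 1 _ f.
rewrite -(@cup_rh_rh _ _ _ M 1 1 2) // (@cup_lh_lh _ _ _ M m 1) ?addn1 //.
rewrite (@cup_lh_rh _ _ _ M 1 m) ?add1n // -/prodB exprS !muln1.
set_sign K m em sq_m.
by lincomb_coefs K; repeat split; ring: sq_m.
Qed.

End Operators.

(** * The brackets on cochains of fixed arity *)

Section Brackets.
Variables (K : fieldType) (A B : lmodType K) (M : matched_pair A B).
Implicit Types (m n : nat) (f g h phi : seq B -> A).
Local Notation act := (actL M).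
Local Notation del := (dif M).

(** The brackets l_1(f) and l_2(f, g) for f of arity m and g of arity n. *)
Definition bracket1 m f : seq B -> A := (-1) ^+ m *: del m f.
Definition bracket2 m n f g : seq B -> A := (-1) ^+ m *: bra M m n f g.

Lemma actLDr n g phi psi : act n g (phi + psi) = act n g phi + act n g psi.
Proof. by rewrite /actL insDr cupDr opprD addrACA. Qed.

Lemma actLNr n g phi : act n g (- phi) = - act n g phi.
Proof. by rewrite /actL insNr cupNr opprD. Qed.

Lemma actLZr n g a phi : act n g (a *: phi) = a *: act n g phi.
Proof. by rewrite /actL insZr cupZr scalerBr. Qed.

Lemma actLZl n a g phi :
  slotwise_linear phi -> act n (a *: g) phi = a *: act n g phi.
Proof.
move=> lphi; rewrite /actL scalerBr cupZl -insZl //; congr (ins _ _ _ - _).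
by rewrite /hat cupZl cupZr scalerBr !scalerA mulrC.
Qed.

Lemma difD n f g : del n (f + g) = del n f + del n g.
Proof.
rewrite /dif insDr cupDl cupDr.
by lincomb_coefs K; repeat split; ring.
Qed.

Lemma difZ n a f : del n (a *: f) = a *: del n f.
Proof.
rewrite /dif insZr cupZl cupZr.
by lincomb_coefs K; repeat split; ring.
Qed.

Lemma bracket1_bracket1 m f : 2%:R != 0 :> K ->
  supported m f -> slotwise_linear f -> bracket1 m.+1 (bracket1 m f) = 0.
Proof.
by move=> nz2 sf lf; rewrite /bracket1 difZ dif_dif // !scaler0.
Qed.

Lemma bracket1_bracket2 a b f g :
  supported a.+1 f -> slotwise_linear f ->
  supported b.+1 g -> slotwise_linear g ->
  bracket1 (a.+1 + b.+1) (bracket2 a.+1 b.+1 f g)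
  + bracket2 a.+2 b.+1 (bracket1 a.+1 f) g
  + (-1) ^+ (a * b) *: bracket2 b.+2 a.+1 (bracket1 b.+1 g) f = 0.
Proof.
move=> sf lf sg lg; rewrite /bracket1 /bracket2 /bra.
rewrite difZ difD -scaleNr difZ dif_actL //.
have dif_act_fg := dif_actL M sg sf lg.
rewrite [(b.+1 + a.+1)%N]addnC in dif_act_fg.
rewrite dif_act_fg !actLZr !actLZl //.
rewrite /defect !(mulSn, mulnS, addSn, addnS, add0n, exprS, exprD).
rewrite [(b * a)%N]mulnC.
set_sign K a ea sq_a; set_sign K b eb sq_b; set_sign K (a * b)%N eab sq_ab.
by lincomb_coefs K; repeat split; ring: sq_a sq_b sq_ab.
Qed.

Lemma bracket2_jacobi a b c f g h :
  supported a.+1 f -> slotwise_linear f ->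
  supported b.+1 g -> slotwise_linear g ->
  supported c.+1 h -> slotwise_linear h ->
  bracket2 (a.+1 + b.+1) c.+1 (bracket2 a.+1 b.+1 f g) h
  + (-1) ^+ (b * c) *: bracket2 (a.+1 + c.+1) b.+1 (bracket2 a.+1 c.+1 f h) g
  + (-1) ^+ (a * (b + c)) *:
    bracket2 (b.+1 + c.+1) a.+1 (bracket2 b.+1 c.+1 g h) f = 0.
Proof.
move=> sf lf sg lg sh lh.
(* the operator L of a bracket is expanded with actL_comm *)
have E x y z f1 f2 f3 : supported x.+1 f1 -> supported y.+1 f2 ->
   slotwise_linear f3 ->
   bracket2 (x.+1 + y.+1) z.+1 (bracket2 x.+1 y.+1 f1 f2) f3 =
   (-1) ^+ y.+1 *: (act z.+1 f3 (act y.+1 f2 f1)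
     - (-1) ^+ (x.+1 * y.+1) *: act z.+1 f3 (act x.+1 f1 f2)
     - (-1) ^+ ((x.+1 + y.+1) * z.+1) *:
      (act y.+1 f2 (act x.+1 f1 f3)
       - (-1) ^+ (x.+1 * y.+1) *: act x.+1 f1 (act y.+1 f2 f3))).
  move=> s1 s2 l3; rewrite actL_comm // /bracket2 {1}/bra actLZr actLZl //.
  rewrite {1}/bra actLDr actLNr actLZr.
  rewrite !(mulSn, mulnS, addSn, addnS, add0n, exprS, exprD).
  set_sign K x ea sq_a; set_sign K y eb sq_b; set_sign K (x * y)%N eab sq_ab.
  move: ((-1) ^+ _) => ec; move: ((-1) ^+ _) => ed.
  by lincomb_coefs K; repeat split; ring: sq_a sq_b sq_ab.
rewrite !E //.
rewrite !(mulSn, mulnS, addSn, addnS, add0n, mulnDl, mulnDr, exprS, exprD).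
rewrite [(b * a)%N]mulnC [(c * a)%N]mulnC [(c * b)%N]mulnC.
set_sign K a ea sq_a; set_sign K b eb sq_b; set_sign K c ec sq_c.
set_sign K (a * b)%N eab sq_ab; set_sign K (a * c)%N eac sq_ac.
set_sign K (b * c)%N ebc sq_bc.
by lincomb_coefs K; repeat split; ring: sq_a sq_b sq_c sq_ab sq_ac sq_bc.
Qed.

End Brackets.

Section BracketProperties.
Variables (K : fieldType) (A B : lmodType K) (M : matched_pair A B).
Implicit Types (m n : nat) (f g h phi : seq B -> A).

Lemma actLPl n a f g phi : slotwise_linear phi ->
  actL M n (a *: f + g) phi = a *: actL M n f phi + actL M n g phi.
Proof.
move=> lphi; rewrite -actLZl // /actL cupDl.
have -> : hat M n (a *: f + g) = hat M n (a *: f) + hat M n g.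
  by rewrite /hat !cupLin; lincomb_coefs K; repeat split; ring.
by rewrite insDl // opprD addrACA.
Qed.

Lemma bracket1P m a f g :
  bracket1 M m (a *: f + g) = a *: bracket1 M m f + bracket1 M m g.
Proof.
rewrite /bracket1 difD difZ.
by lincomb_coefs K; repeat split; ring.
Qed.

Lemma bracket2Pl m n a f g h : slotwise_linear h ->
  bracket2 M m n (a *: f + g) h = a *: bracket2 M m n f h + bracket2 M m n g h.
Proof.
move=> lh; rewrite /bracket2 /bra actLPl // actLDr actLZr.
by lincomb_coefs K; repeat split; ring.
Qed.

(** Graded symmetry, f and g being of degrees m - 1 and n - 1; the exponent has
    the parity of (m - 1)(n - 1). *)
Lemma bracket2C m n f g :
  bracket2 M m n f g = (-1) ^+ (m.+1 * n.+1) *: bracket2 M n m g f.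
Proof.
rewrite /bracket2 /bra [(n * m)%N]mulnC !(mulSn, mulnS, exprS, exprD).
set_sign K m em sq_m; set_sign K n en sq_n; set_sign K (m * n)%N emn sq_mn.
by lincomb_coefs K; repeat split; ring: sq_m sq_n sq_mn.
Qed.

Lemma bracket2Pr m n a f g h : slotwise_linear h ->
  bracket2 M m n h (a *: f + g) = a *: bracket2 M m n h f + bracket2 M m n h g.
Proof.
move=> lh; rewrite bracket2C bracket2Pl //.
rewrite (bracket2C _ _ h f) (bracket2C _ _ h g).
by lincomb_coefs K; repeat split; ring.
Qed.

Lemma bracket1_supported m f :
  supported m f -> slotwise_linear f -> supported m.+1 (bracket1 M m f).
Proof.
move=> sf lf; apply/supportedZ/supportedD; first apply: supportedD.
- by rewrite -addn1; apply: ins_supported => //; exact: prodB_supported.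
- apply: supportedN; rewrite -add1n; apply: cup_supported sf.
  exact: idc_supported.
- apply: supportedZ; rewrite -addn1; apply: cup_supported => //.
  exact: idc_supported.
Qed.

Lemma actL_supported m n f g :
  supported m f -> slotwise_linear f -> supported n g ->
  supported (n + m) (actL M n g f).
Proof.
move=> sf lf sg; apply: supportedD; last by apply/supportedN/cup_supported.
by rewrite addnC; apply: ins_supported => //; exact: hat_supported.
Qed.

Lemma bracket2_supported m n f g :
  supported m f -> slotwise_linear f -> supported n g -> slotwise_linear g ->
  supported (m + n) (bracket2 M m n f g).
Proof.
move=> sf lf sg lg; apply/supportedZ/supportedD; last first.
  by apply/supportedN/supportedZ/actL_supported.
by rewrite addnC; apply: actL_supported.
Qed.

End BracketProperties.

(** * Comparison with the explicit formulas *)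

Section InsertionSums.
Variables (K : fieldType) (U V : lmodType K).

Lemma ins_sum m b (beta : seq U -> U) (phi : seq U -> V) s :
  supported m phi -> size s = (m + b)%N ->
  ins b beta phi s =
  \sum_(1 <= i < m.+1) (-1) ^+ ((i - 1) * b) *:
    phi (take (i - 1) s ++ beta (take b.+1 (drop (i - 1) s)) :: drop (i + b) s).
Proof.
rewrite big_add1 big_mkord.
elim: m s phi => [|m IHm] [|x s] phi sphi szs.
- by rewrite big_ord0.
- by rewrite big_ord0 ins_supported0.
- by [].
rewrite big_ord_recl ins_cons (IHm s _ (supported_shift x sphi)); last first.
  by case: szs.
rewrite mul0n scale1r; congr (_ + _).
rewrite scaler_sumr; apply: eq_bigr => i _.
by rewrite scalerA -exprD /= !subn1 /= -mulSn.
Qed.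

End InsertionSums.

Section Transfer.
Variables (K : fieldType) (A B : lmodType K) (M : matched_pair A B).
Implicit Types (m n p : nat).

(** f' is a function on all words that represents the cochain f. *)
Definition extends m (f : multihom B A m) (f' : seq B -> A) :=
  [/\ forall s, size s = m -> app f s = f' s, supported m f'
    & slotwise_linear f'].

Lemma idc_nth0 (s : seq B) : size s = 1%N -> idc s = s`_0.
Proof. by case: s => [|x []]. Qed.

Lemma size_insert (x : B) (s : seq B) m n j k :
  size s = (m + n)%N -> (j < m)%N -> k = (j.+1 + n)%N ->
  size (take j s ++ x :: drop k s) = m.
Proof.
by move=> szs jm ->; rewrite size_cat /= size_drop size_takel szs; lia.
Qed.

Lemma idc_take_drop (s : seq B) j :
  (j < size s)%N -> idc (take 1 (drop j s)) = s`_j.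
Proof.
move=> js; rewrite idc_nth0 ?nth_take ?nth_drop ?addn0 //.
by rewrite size_takel // size_drop subn_gt0.
Qed.

Lemma l1_fun_bracket1 m (f : multihom B A m) f' s :
  extends f f' -> size s = m.+1 -> l1_fun M f s = bracket1 M m f' s.
Proof.
move=> [ff' sf lf] szs; rewrite /bracket1 /dif fctZE !fctDE fctNE fctZE.
rewrite (ins_sum _ sf) ?addn1 // !scalerDr scalerN scalerA signr_sq scale1r.
rewrite /l1_fun seg1 !addn1 -[2%N]/(1.+1) seg_end //.
rewrite !ff' ?size_drop ?szs ?subn1 ?size_takel ?szs //.
rewrite /cup idc_nth0; last by rewrite size_takel // szs.
rewrite (@idc_nth0 (drop m s)); last by rewrite size_drop szs subSnn.
rewrite nth_take // nth_drop addn0 /ent /= exprS mulN1r scaleNr.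
rewrite [X in _ + X = _](_ : _ = (-1) ^+ m *: \sum_(1 <= i < m.+1)
  (-1) ^+ ((i - 1) * 1) *: f' (take (i - 1) s ++
    prodB M (take 2 (drop (i - 1) s)) :: drop (i + 1) s)).
  by rewrite addrC addrA.
rewrite scaler_sumr; apply: eq_big_nat => -[//|j] /andP[_ jm].
rewrite !subn1 /= muln1 scalerA -exprD addn1 addSn exprS addSn exprS.
rewrite mulrA mulrN1 opprK mul1r.
rewrite [(j + m)%N]addnC; congr (_ *: _).
rewrite seg1 addn2 seg_end // -ff'; last first.
  by rewrite (size_insert _ (m := m) (n := 1)) ?addn1.
congr (app _ (_ ++ _ :: _)); last by rewrite addn1.
rewrite /prodB /cup take_takel // -(take_drop 1 1) drop_drop.
rewrite idc_take_drop ?szs 1?ltnW // addn1.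
by rewrite idc_take_drop ?szs // /ent addn1.
Qed.

Lemma insert_fun_ins m n (f : multihom B A m) (g : multihom B A n) f' g' s :
  extends f f' -> extends g g' -> size s = (m + n)%N ->
  insert_fun M f g s = ins n (hat M n g') f' s.
Proof.
move=> [ff' sf lf] [gg' sg lg] szs.
rewrite /hat insDl // -scaleNr insZl // fctDE fctZE !(ins_sum _ sf) //.
rewrite scaleNr scaler_sumr /insert_fun.
have size_g j : (j < m)%N -> size (take n (drop j s)) = n.
  by move=> jm; rewrite size_takel // size_drop szs; lia.
have size_g' j : (j < m)%N -> size (take n (drop j.+1 s)) = n.
  by move=> jm; rewrite size_takel // size_drop szs; lia.
congr (_ - _); apply: eq_big_nat => -[//|j] /andP[_ jm].
  rewrite subn1 /=; congr (_ *: _).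
  rewrite seg1 [(j.+1 + n + 1)%N]addn1 (seg_end _ szs).
  rewrite ff' ?(size_insert _ szs) //; congr (f' (_ ++ _ :: _)).
  rewrite /seg addSn subn1 /= addnC -take_drop gg' ?size_g //.
  rewrite /cup take_takel // -[n.+1]add1n -take_drop drop_drop.
  by rewrite idc_take_drop // szs; lia.
rewrite subn1 /= scalerA mulSn exprD; congr (_ *: _).
rewrite seg1 [(j.+1 + n + 1)%N]addn1 (seg_end _ szs).
rewrite ff' ?(size_insert _ szs) //.
congr (f' (_ ++ _ :: _)); rewrite /seg addn1 /= [(j.+1 + n)%N]addnC -take_drop.
rewrite gg' ?size_g' // /cup take_takel // idc_take_drop; last first.
  by rewrite szs; lia.
by rewrite -[n.+1]addn1 -take_drop drop_drop add1n.
Qed.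

Lemma l2_fun_bracket2 m n (f : multihom B A m) (g : multihom B A n) f' g' s :
  extends f f' -> extends g g' -> size s = (m + n)%N ->
  l2_fun M f g s = bracket2 M m n f' g' s.
Proof.
move=> ef eg szs; rewrite /l2_fun (insert_fun_ins ef eg) //.
rewrite (insert_fun_ins eg ef) 1?addnC //.
have [ff' _ _] := ef; have [gg' _ _] := eg.
have szm : size (take m s) = m by rewrite size_takel // szs leq_addr.
have szn : size (take n s) = n by rewrite size_takel // szs leq_addl.
rewrite !seg1 !addn1 !(seg_end _ szs).
rewrite ff' // gg' ?size_drop ?szs ?addKn //.
rewrite gg' // ff' ?size_drop ?szs ?addnK //.
rewrite /bracket2 /bra /actL !(fctDE, fctNE, fctZE) mulnS exprD.
rewrite -!/(cup _ _ _ _ _).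
set_sign K m em sq_m; set_sign K (m * n)%N emn sq_mn.
by lincomb_coefs K; repeat split; ring.
Qed.

End Transfer.

(** * The direct sum of the spaces of cochains *)

Section TotalFunction.
Variables (K : fieldType) (A B : lmodType K) (M : matched_pair A B).
Implicit Types (m n p : nat) (F G H : dsum (cochains A B)).

Local Notation comp F n := (F (Posz n) : multihom B A n.+1).

(** The extension of a cochain by 0 to the words of other lengths. *)
Definition ext m (f : multihom B A m) (s : seq B) : A :=
  if size s == m then app f s else 0.

Lemma app_tuple m (f : multihom B A m) (x : m.-tuple B) : app f x = f x.
Proof.
rewrite /app; congr (multihom_fun f _); apply: eq_from_tnth => i.
by rewrite tnth_mktuple -tnth_nth.
Qed.

Lemma slotwise_lin3 (f : seq B -> A) :
  (forall n, lin3_on n f) -> slotwise_linear f.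
Proof.
move=> lf p q a u v; apply: (lf (size (p ++ u :: q))) => //.
by exists p, u, v, q.
Qed.

Lemma ext_extends m (f : multihom B A m) : extends f (ext f).
Proof.
split=> [s szs|s /negPf szs|]; rewrite /ext ?szs ?eqxx //.
apply: slotwise_lin3 => n a s1 s2 s3 s123 sz.
have [sz2 sz3] := lin3_size s123; rewrite sz2 sz3 sz.
case: eqP => [nm|_]; last by rewrite scaler0 addr0.
by rewrite (lin3_on_app f s123) // sz.
Qed.

Lemma ext_slotwise m (f : multihom B A m) : slotwise_linear (ext f).
Proof. by have [] := ext_extends f. Qed.

Lemma extP m a (f g : multihom B A m) : ext (a *: f + g) = a *: ext f + ext g.
Proof.
apply/funext => s; rewrite fctDE fctZE /ext.
by case: eqP => // _; rewrite scaler0 addr0.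
Qed.

(** An element of the direct sum as a single function on words: its component of
    degree n is evaluated on the words of length n + 1.  The value at the empty
    word is 0, as there are no cochains of arity 0. *)
Definition cfun F (s : seq B) : A :=
  if size s is n.+1 then app (F (Posz n)) s else 0.

Lemma cfun_linear : linear cfun.
Proof.
move=> a F G; apply/funext => s; rewrite fctDE fctZE /cfun.
by case: (size s) => //; rewrite scaler0 addr0.
Qed.

HB.instance Definition _ :=
  GRing.isLinear.Build K (dsum (cochains A B)) (seq B -> A) _ cfun cfun_linear.

Lemma cfun_tuple F n (x : n.+1.-tuple B) : cfun F x = (comp F n) x.
Proof. by rewrite /cfun size_tuple app_tuple. Qed.

Lemma cfun_inj : injective cfun.
Proof.
move=> F G FG; apply: dsum_ext => -[n|n].
  by apply: multihom_ext => x; rewrite -!cfun_tuple FG.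
by apply/matrixP => i [].
Qed.

Lemma cfun_slotwise F : slotwise_linear (cfun F).
Proof.
apply: slotwise_lin3 => n a s1 s2 s3 s123 sz.
have [sz2 sz3] := lin3_size s123; rewrite /cfun sz2 sz3 sz.
case: n sz => [|n] sz; first by rewrite scaler0 addr0.
exact: (lin3_on_app _ s123).
Qed.

Lemma cfun_supported n F : homogeneous (Posz n) F -> supported n.+1 (cfun F).
Proof.
move=> hF s; rewrite /cfun; case: (size s) => // k kn.
by rewrite (hF (Posz k)).
Qed.

(** The components of negative degree are trivial. *)
Lemma homogeneous_negz n F : homogeneous (Negz n) F -> F = 0.
Proof.
move=> hF; apply: dsum_ext => -[k|k]; first by rewrite hF.
by apply/matrixP => i [].
Qed.

Lemma l1_comp_eq F n (x : n.+2.-tuple B) :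
  (comp (l1_comp M F) n.+1) x = bracket1 M n.+1 (ext (comp F n)) x.
Proof.
by apply: l1_fun_bracket1; [exact: ext_extends | rewrite size_tuple].
Qed.

Lemma multihom_sumE (I : finType) n (f : I -> multihom B A n) x :
  (\sum_i f i) x = \sum_i f i x.
Proof. by apply: (big_morph (fun g : multihom B A n => g x)). Qed.

Lemma l2_comp_eq F G p (x : p.+1.-tuple B) :
  (comp (l2_comp M F G) p) x =
  \sum_(i < p) bracket2 M i.+1 (p - i.+1).+1
    (ext (comp F i)) (ext (comp G (p - i.+1))) x.
Proof.
rewrite [LHS]multihom_sumE; apply: eq_bigr => i _.
apply: l2_fun_bracket2; try exact: ext_extends.
by rewrite size_tuple; exact: l2_degree.
Qed.

Lemma l1_tot_linear : linear (l1_tot M).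
Proof.
move=> a F G; apply: dsum_ext => -[[|n]|n] /=; try by rewrite scaler0 addr0.
apply: multihom_ext => x; rewrite [LHS](l1_comp_eq (a *: F + G) x).
by rewrite extP bracket1P fctDE fctZE -!l1_comp_eq.
Qed.

Lemma l2_tot_linearl a F G H :
  l2_tot M (a *: F + G) H = a *: l2_tot M F H + l2_tot M G H.
Proof.
apply: dsum_ext => -[p|n]; last by rewrite /= scaler0 addr0.
apply: multihom_ext => x; rewrite [LHS]l2_comp_eq.
transitivity (a *: (comp (l2_comp M F H) p) x + (comp (l2_comp M G H) p) x);
  last by [].
rewrite !l2_comp_eq scaler_sumr -big_split; apply: eq_bigr => i _ /=.
by rewrite extP bracket2Pl //; exact: ext_slotwise.
Qed.

Lemma l2_tot_linearr a F G H :
  l2_tot M H (a *: F + G) = a *: l2_tot M H F + l2_tot M H G.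
Proof.
apply: dsum_ext => -[p|n]; last by rewrite /= scaler0 addr0.
apply: multihom_ext => x; rewrite [LHS]l2_comp_eq.
transitivity (a *: (comp (l2_comp M H F) p) x + (comp (l2_comp M H G) p) x);
  last by [].
rewrite !l2_comp_eq scaler_sumr -big_split; apply: eq_bigr => i _ /=.
by rewrite extP bracket2Pr //; exact: ext_slotwise.
Qed.

End TotalFunction.

Section TotalBrackets.
Variables (K : fieldType) (A B : lmodType K) (M : matched_pair A B).
Implicit Types (m n p a b c : nat) (F G H : dsum (cochains A B)).

Lemma l1_tot0 : l1_tot M 0 = 0.
Proof. exact: linear_map0 (l1_tot_linear M). Qed.

Lemma l2_tot0l F : l2_tot M 0 F = 0.
Proof.
by apply: (@linear_map0 _ _ _ ((l2_tot M)^~ F)) => a G H; exact: l2_tot_linearl.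
Qed.

Lemma l2_tot0r F : l2_tot M F 0 = 0.
Proof. by apply: linear_map0 => a G H; exact: l2_tot_linearr. Qed.

Definition tot0E := (l1_tot0, l2_tot0l, l2_tot0r, @scaler0, @addr0).

Lemma ext0 m : ext (0 : multihom B A m) = 0.
Proof. by apply/funext => s; rewrite /ext; case: ifP. Qed.

Lemma bracket1_0 m : bracket1 M m 0 = 0.
Proof. by apply: linear_map0 => a f g; exact: bracket1P. Qed.

Lemma bracket2_0l m n f : slotwise_linear f -> bracket2 M m n 0 f = 0.
Proof.
move=> lf; apply: (@linear_map0 _ _ _ ((bracket2 M m n)^~ f)) => a g h.
exact: bracket2Pl.
Qed.

Lemma bracket2_0r m n f : slotwise_linear f -> bracket2 M m n f 0 = 0.
Proof. by move=> lf; apply: linear_map0 => a g h; exact: bracket2Pr. Qed.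

Lemma l1_tot_homogeneous d F :
  homogeneous d F -> homogeneous (d + 1) (l1_tot M F).
Proof.
move=> hF [[|n]|n] neq //=; apply: multihom_ext => x.
rewrite [LHS](l1_comp_eq M F x) hF ?ext0 ?bracket1_0 //.
by apply: contra_neq neq => <-; rewrite -PoszD addn1.
Qed.

Lemma l2_tot_homogeneous d e F G :
  homogeneous d F -> homogeneous e G -> homogeneous (d + e + 1) (l2_tot M F G).
Proof.
move=> hF hG [p|n] neq //=; apply: multihom_ext => x.
rewrite [LHS](l2_comp_eq M F G x) big1 // => i _.
have [id|/hF ->] := eqVneq (Posz i) d; last first.
  by rewrite ext0 bracket2_0l //; exact: ext_slotwise.
rewrite hG ?ext0 ?bracket2_0r //; first exact: ext_slotwise.
apply: contra_neq neq => <-; rewrite -id; have := ltn_ord i; lia.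
Qed.

Lemma ext_cfun n F : homogeneous (Posz n) F ->
  ext (F (Posz n) : multihom B A n.+1) = cfun F.
Proof.
move=> hF; apply/funext => s; rewrite /ext; case: eqP => [szs|/eqP szs].
  by rewrite /cfun szs.
by rewrite (cfun_supported hF).
Qed.

Lemma cfun_l1_tot n F : homogeneous (Posz n) F ->
  cfun (l1_tot M F) = bracket1 M n.+1 (cfun F).
Proof.
move=> hF; apply/funext => s.
have [szs|szs] := eqVneq (size s) n.+2; last first.
  have s1 := bracket1_supported M (cfun_supported hF) (cfun_slotwise F).
  rewrite s1 //; apply: (@cfun_supported _ _ _ n.+1) => //.
  by rewrite -addn1 PoszD; exact: l1_tot_homogeneous.
rewrite -(in_tupleE s); move: (in_tuple s); rewrite szs => x.
by rewrite cfun_tuple [LHS](l1_comp_eq M F x) ext_cfun.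
Qed.

Lemma cfun_l2_tot m n F G : homogeneous (Posz m) F -> homogeneous (Posz n) G ->
  cfun (l2_tot M F G) = bracket2 M m.+1 n.+1 (cfun F) (cfun G).
Proof.
move=> hF hG; apply/funext => s.
have [szs|szs] := eqVneq (size s) (m.+1 + n.+1)%N; last first.
  have s2 := bracket2_supported M (cfun_supported hF) (cfun_slotwise F)
    (cfun_supported hG) (cfun_slotwise G).
  rewrite s2 //; apply: (@cfun_supported _ _ _ (m + n + 1)).
    by rewrite !PoszD; exact: l2_tot_homogeneous.
  by move: szs; rewrite addSn addnS addn1.
rewrite -(in_tupleE s); move: (in_tuple s); rewrite szs addSn => x.
rewrite cfun_tuple [LHS](l2_comp_eq M F G x).
have ltm : (m < m + n.+1)%N by rewrite addnS ltnS leq_addr.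
rewrite (bigD1 (Ordinal ltm)) //= big1 => [|i neq]; last first.
  by rewrite hF ?ext0 ?bracket2_0l //; exact: ext_slotwise.
have -> : (m + n.+1 - m.+1)%N = n by lia.
by rewrite addr0 !ext_cfun.
Qed.

Lemma l2_totC m n F G : homogeneous (Posz m) F -> homogeneous (Posz n) G ->
  l2_tot M F G = (-1) ^+ (m * n) *: l2_tot M G F.
Proof.
move=> hF hG; apply: cfun_inj.
rewrite linearZ /= (cfun_l2_tot hF hG) (cfun_l2_tot hG hF).
rewrite bracket2C; congr (_ *: _).
by rewrite -signr_odd oddM /= !negbK -oddM signr_odd.
Qed.

Lemma l1_tot_l1_tot n F : 2%:R != 0 :> K -> homogeneous (Posz n) F ->
  l1_tot M (l1_tot M F) = 0.
Proof.
move=> nz2 hF; apply: cfun_inj; rewrite linear0.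
rewrite (@cfun_l1_tot n.+1) ?(@cfun_l1_tot n) //.
  apply: bracket1_bracket1 => //; first exact: cfun_supported.
  exact: cfun_slotwise.
by rewrite -addn1 PoszD; exact: l1_tot_homogeneous.
Qed.

Lemma l1_tot_l2_tot a b F G :
  homogeneous (Posz a) F -> homogeneous (Posz b) G ->
  l1_tot M (l2_tot M F G) + l2_tot M (l1_tot M F) G
  + (-1) ^+ (a * b) *: l2_tot M (l1_tot M G) F = 0.
Proof.
move=> hF hG; apply: cfun_inj.
have hFG : homogeneous (Posz (a + b.+1)) (l2_tot M F G).
  by rewrite -addn1 addnA !PoszD; exact: l2_tot_homogeneous.
have h1F : homogeneous (Posz a.+1) (l1_tot M F).
  by rewrite -addn1 PoszD; exact: l1_tot_homogeneous.
have h1G : homogeneous (Posz b.+1) (l1_tot M G).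
  by rewrite -addn1 PoszD; exact: l1_tot_homogeneous.
rewrite linear0 !linearD linearZ /= (cfun_l1_tot hFG) (cfun_l2_tot hF hG).
rewrite (cfun_l2_tot h1F hG) (cfun_l2_tot h1G hF).
rewrite (cfun_l1_tot hF) (cfun_l1_tot hG).
by apply: bracket1_bracket2;
  first [exact: cfun_supported | exact: cfun_slotwise].
Qed.

Lemma l2_tot_jacobi a b c F G H :
  homogeneous (Posz a) F -> homogeneous (Posz b) G ->
  homogeneous (Posz c) H ->
  l2_tot M (l2_tot M F G) H
  + (-1) ^+ (b * c) *: l2_tot M (l2_tot M F H) G
  + (-1) ^+ (a * (b + c)) *: l2_tot M (l2_tot M G H) F = 0.
Proof.
move=> hF hG hH; apply: cfun_inj.
have h2 m n F1 F2 : homogeneous (Posz m) F1 -> homogeneous (Posz n) F2 ->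
    homogeneous (Posz (m + n.+1)) (l2_tot M F1 F2).
  by move=> h1 h2; rewrite -addn1 addnA !PoszD; exact: l2_tot_homogeneous.
rewrite linear0 !linearD !linearZ /=.
rewrite (cfun_l2_tot (h2 _ _ _ _ hF hG) hH) (cfun_l2_tot hF hG).
rewrite (cfun_l2_tot (h2 _ _ _ _ hF hH) hG) (cfun_l2_tot hF hH).
rewrite (cfun_l2_tot (h2 _ _ _ _ hG hH) hF) (cfun_l2_tot hG hH).
by apply: bracket2_jacobi;
  first [exact: cfun_supported | exact: cfun_slotwise].
Qed.

End TotalBrackets.

(** * Shuffles and Koszul signs of at most three elements *)

Section SmallShuffles.

Definition ord3_1 : 'I_3 := lift ord0 ord0.
Definition ord3_2 : 'I_3 := lift ord0 (lift ord0 ord0).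

Lemma ord3P (P : 'I_3 -> Prop) :
  P ord0 -> P ord3_1 -> P ord3_2 -> forall i, P i.
Proof.
move=> P0 P1 P2 [[|[|[|//]]] lti].
- by rewrite (_ : Ordinal _ = ord0) //; exact: val_inj.
- by rewrite (_ : Ordinal _ = ord3_1) //; exact: val_inj.
- by rewrite (_ : Ordinal _ = ord3_2) //; exact: val_inj.
Qed.

Lemma ord2P (P : 'I_2 -> Prop) : P ord0 -> P (lift ord0 ord0) -> forall i, P i.
Proof.
move=> P0 P1 [[|[|//]] lti].
- by rewrite (_ : Ordinal _ = ord0) //; exact: val_inj.
- by rewrite (_ : Ordinal _ = lift ord0 ord0) //; exact: val_inj.
Qed.

Lemma shufflesP N i (s : 'S_N) :
  reflect (forall a b : 'I_N,
      (a < b)%N -> (b < i)%N || (i <= a)%N -> (s a < s b)%N)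
    (s \in shuffles N i).
Proof.
rewrite inE; apply: (iffP forallP) => [H a b ab bi|H a].
  by have /forallP/(_ b) := H a; rewrite ab bi.
by apply/forallP => b; apply/implyP => /andP[]; exact: H.
Qed.

(** The permutations (0, 2, 1) and (1, 2, 0), given by their lists of values. *)
Definition swap3 : 'S_3 := tperm ord3_1 ord3_2.
Definition rot3 : 'S_3 := (tperm ord0 ord3_1 * tperm ord0 ord3_2)%g.

Lemma swap3E :
  [/\ swap3 ord0 = ord0, swap3 ord3_1 = ord3_2 & swap3 ord3_2 = ord3_1].
Proof. by rewrite /swap3 tpermL tpermR tpermD. Qed.

Lemma rot3E :
  [/\ rot3 ord0 = ord3_1, rot3 ord3_1 = ord3_2 & rot3 ord3_2 = ord0].
Proof.
rewrite /rot3 !permM tpermL tpermR tpermD // (@tpermD _ ord0 ord3_1 ord3_2) //.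
by rewrite tpermL tpermR.
Qed.

Lemma shuffles32 : shuffles 3 2 = [set 1%g; swap3; rot3].
Proof.
have [s0 s1 s2] := swap3E; have [r0 r1 r2] := rot3E.
apply/setP => s; apply/shufflesP/idP => [sh|].
  have /= s01 := sh ord0 ord3_1 isT isT.
  have n02 : s ord0 != s ord3_2 by rewrite (inj_eq perm_inj).
  have n12 : s ord3_1 != s ord3_2 by rewrite (inj_eq perm_inj).
  rewrite !inE -!orbA.
  have E (p : 'S_3) : (s ord0 = p ord0 :> nat) ->
      (s ord3_1 = p ord3_1 :> nat) -> (s ord3_2 = p ord3_2 :> nat) -> s == p.
    by move=> e0 e1 e2; apply/eqP/permP; apply: ord3P; exact: val_inj.
  move: n02 n12; rewrite -!val_eqE /=.
  have := ltn_ord (s ord3_2); have := ltn_ord (s ord3_1) => lt1.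
  case E2: (nat_of_ord (s ord3_2)) => [|[|[|//]]] _ n02 n12.
  - by apply/or3P/Or33/E; rewrite ?r0 ?r1 ?r2 ?E2 //= /bump /=; lia.
  - by apply/or3P/Or32/E; rewrite ?s0 ?s1 ?s2 ?E2 //= /bump /=; lia.
  - by apply/or3P/Or31/E; rewrite ?perm1 ?E2 //= /bump /=; lia.
have lem01 (p : 'S_3) : (p ord0 < p ord3_1)%N -> forall a b : 'I_3,
    (a < b)%N -> (b < 2)%N || (2 <= a)%N -> (p a < p b)%N.
  by move=> p01; apply: ord3P; apply: ord3P.
rewrite !inE -orbA => /or3P[] /eqP ->; apply: lem01.
- by rewrite !perm1.
- by rewrite s0 s1.
- by rewrite r0 r1.
Qed.

Lemma sum_shuffles32 (V : nmodType) (F : 'S_3 -> V) :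
  \sum_(s in shuffles 3 2) F s = F 1%g + F swap3 + F rot3.
Proof.
have [s0 s1 s2] := swap3E; have [r0 r1 r2] := rot3E.
rewrite shuffles32 -setUA big_setU1 /=; last first.
  rewrite !inE negb_or; apply/andP; split; apply/eqP => /permP E.
    by have := E ord3_1; rewrite perm1 s1 => /(congr1 val).
  by have := E ord0; rewrite perm1 r0 => /(congr1 val).
rewrite big_setU1 /= ?big_set1 ?addrA // inE; apply/eqP => /permP E.
by have := E ord0; rewrite s0 r0 => /(congr1 val).
Qed.

Definition swap2 : 'S_2 := tperm ord0 (lift ord0 ord0).

Lemma perm2P (s : 'S_2) : s = 1%g \/ s = swap2.
Proof.
have n01 : s ord0 != s (lift ord0 ord0) by rewrite (inj_eq perm_inj).
have E (p : 'S_2) : (s ord0 = p ord0 :> nat) ->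
    (s (lift ord0 ord0) = p (lift ord0 ord0) :> nat) -> s = p.
  by move=> e0 e1; apply/permP; apply: ord2P; exact: val_inj.
move: n01; rewrite -val_eqE /=.
have := ltn_ord (s (lift ord0 ord0)).
case E0: (nat_of_ord (s ord0)) (ltn_ord (s ord0)) => [|[|//]] _ lt1 n01;
  [left|right]; apply: E.
- by rewrite perm1 E0.
- rewrite perm1 /= /bump /=; lia.
- by rewrite /swap2 tpermL E0.
- rewrite /swap2 tpermR /=; lia.
Qed.

Lemma shuffles22 : shuffles 2 2 = [set 1%g].
Proof.
apply/setP => s; rewrite [RHS]inE; apply/shufflesP/eqP => [sh|-> a b].
  have /= := sh ord0 (lift ord0 ord0) isT isT.
  by have [|->] := perm2P s; rewrite // /swap2 tpermL tpermR.
by rewrite !perm1.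
Qed.

Lemma shuffles21 : shuffles 2 1 = [set 1%g; swap2].
Proof.
apply/setP => s; apply/shufflesP/idP => [_|_]; last by do 2!apply: ord2P.
by rewrite !inE; have [->|->] := perm2P s; rewrite eqxx ?orbT.
Qed.

Lemma sum_shuffles21 (V : nmodType) (F : 'S_2 -> V) :
  \sum_(s in shuffles 2 1) F s = F 1%g + F swap2.
Proof.
rewrite shuffles21 big_setU1 /= ?big_set1 // inE; apply/eqP => /permP/(_ ord0).
by rewrite perm1 /swap2 tpermL => /(congr1 val).
Qed.

End SmallShuffles.

Section SmallKoszul.
Variables (K : fieldType).

Lemma koszul1 N (d : 'I_N -> int) : koszul K d 1 = 1.
Proof.
rewrite /koszul big1 // => i _; rewrite big1 // => j /andP[ij].
by rewrite !perm1 ltnNge (ltnW ij).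
Qed.

Lemma koszul2 (d : 'I_2 -> int) (s : 'S_2) :
  koszul K d s = if (s (lift ord0 ord0) < s ord0)%N
    then (-1) ^ (d (s ord0) * d (s (lift ord0 ord0))) else 1.
Proof.
rewrite /koszul.
under eq_bigr => i _ do rewrite big_mkcond !big_ord_recl big_ord0.
by rewrite !big_ord_recl big_ord0 /= /bump /= !mulr1 ?mul1r ?mulr1.
Qed.

Lemma koszul3 (d : 'I_3 -> int) (s : 'S_3) :
  let e i j := if (s j < s i)%N then (-1) ^ (d (s i) * d (s j)) else 1 in
  koszul K d s = e ord0 ord3_1 * e ord0 ord3_2 * e ord3_1 ord3_2.
Proof.
rewrite /koszul.
under eq_bigr => i _ do rewrite big_mkcond !big_ord_recl big_ord0.
by rewrite !big_ord_recl big_ord0 /= /bump /= !mulr1 ?mul1r ?mulr1.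
Qed.

End SmallKoszul.

(** * The structure on the direct sum and its Maurer-Cartan elements *)

Section Structure.
Variables (K : fieldType) (A B : lmodType K) (M : matched_pair A B).
Local Notation dsumC := (dsum (cochains A B)).
Local Notation l k := (@cochain_l K A B M k).

Lemma app_cochain_l1 (s : seq dsumC) : app (l 1) s = l1_tot M s`_0.
Proof. by rewrite /app /= tnth_mktuple. Qed.

Lemma app_cochain_l2 (s : seq dsumC) : app (l 2) s = l2_tot M s`_0 s`_1.
Proof. by rewrite /app /= !tnth_mktuple. Qed.

Lemma app_cochain_l_ge3 k (s : seq dsumC) : (2 < k)%N -> app (l k) s = 0.
Proof. by case: k => [|[|[|k]]]. Qed.

Lemma app_cochain_l0 k (s : seq dsumC) : app (l k) (0 :: s) = 0.
Proof.
case: k => [|[|[|k]]] //; first by rewrite app_cochain_l1 l1_tot0.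
by rewrite app_cochain_l2 l2_tot0l.
Qed.

Lemma cochain_l_multilinear k : (0 < k)%N -> multilinear (l k).
Proof.
case: k => [//|[|[|k]]] _ i x a u v /=; last by rewrite scaler0 addr0.
  by rewrite !tnth_mktuple [i]ord1 eqxx l1_tot_linear.
rewrite !tnth_mktuple; move: i; apply: ord2P; rewrite /= ?eqxx.
  by rewrite l2_tot_linearl.
by rewrite l2_tot_linearr.
Qed.

Lemma cochain_l_degree k (d : 'I_k -> int) (x : k.-tuple dsumC) :
  (0 < k)%N -> (forall i, homogeneous (d i) (tnth x i)) ->
  homogeneous (\sum_(i < k) d i + 1) (l k x).
Proof.
case: k d x => [//|[|[|k]]] d x _ hx //=.
  by rewrite big_ord1; exact: l1_tot_homogeneous.
rewrite !big_ord_recl big_ord0 addr0.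
have -> : ord_max = lift ord0 ord0 :> 'I_2 by exact: val_inj.
exact: l2_tot_homogeneous.
Qed.

Lemma exprz_natM (a b : nat) : (-1 : K) ^ (Posz a * Posz b) = (-1) ^+ (a * b).
Proof. by []. Qed.

Lemma cochain_l_symmetric k (d : 'I_k -> int) (x : k.-tuple dsumC) (s : 'S_k) :
  (0 < k)%N -> (forall i, homogeneous (d i) (tnth x i)) ->
  l k x = koszul K d s *: l k [tuple tnth x (s i) | i < k].
Proof.
case: k d x s => [//|[|[|k]]] d x s _ hx; last by rewrite /= scaler0.
  rewrite (_ : s = 1%g) ?koszul1 ?scale1r; last first.
    by apply/permP => i; rewrite !ord1.
  by rewrite /= tnth_mktuple perm1.
have [->|->] := perm2P s.
  by rewrite koszul1 scale1r /= !tnth_mktuple !perm1.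
have max1 : ord_max = lift ord0 ord0 :> 'I_2 by exact: val_inj.
rewrite koszul2 /= !tnth_mktuple max1 /swap2 tpermL tpermR /=.
move: (hx ord0) (hx (lift ord0 ord0)).
move: (tnth x ord0) (tnth x (lift ord0 ord0)) => F G.
case: (d ord0) (d (lift ord0 ord0)) => [a|a] [b|b] hF hG.
- by rewrite mulrC exprz_natM (l2_totC M hF hG) mulnC.
- by rewrite (homogeneous_negz hG) l2_tot0l l2_tot0r scaler0.
- by rewrite (homogeneous_negz hF) l2_tot0l l2_tot0r scaler0.
- by rewrite (homogeneous_negz hF) l2_tot0l l2_tot0r scaler0.
Qed.

Lemma tuple1E T (f : 'I_1 -> T) : [tuple f i | i < 1] = [:: f ord0] :> seq T.
Proof. by rewrite /= !enum_ordSl /= (size0nil (size_enum_ord 0)). Qed.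

Lemma tuple3E T (f : 'I_3 -> T) :
  [tuple f i | i < 3] = [:: f ord0; f ord3_1; f ord3_2] :> seq T.
Proof. by rewrite /= !enum_ordSl /= (size0nil (size_enum_ord 0)). Qed.

Lemma tuple2E T (f : 'I_2 -> T) :
  [tuple f i | i < 2] = [:: f ord0; f (lift ord0 ord0)] :> seq T.
Proof. by rewrite /= !enum_ordSl /= (size0nil (size_enum_ord 0)). Qed.

(** Only the arities 1 and 2 contribute, hence only N <= 3: the square of l_1,
    the derivation property and the Jacobi identity of l_2.  For N > 3 one of
    the two operations in each term has arity at least 3. *)
Lemma cochain_l_jacobi N (d : 'I_N -> int) (x : N.-tuple dsumC) :
  2%:R != 0 :> K -> (0 < N)%N -> (forall i, homogeneous (d i) (tnth x i)) ->
  \sum_(1 <= i < N.+1) \sum_(s in shuffles N i)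
    (let y := [tuple tnth x (s j) | j < N] in
     koszul K d s *:
       app (l (N - i + 1)%N) (app (l i) (take i y) :: drop i y)) = 0.
Proof.
move=> nz2; case: N d x => [//|[|[|[|N]]]] d x _ hx.
- rewrite big_nat1 big1 // => s _; cbv zeta.
  rewrite -[(1 - 1 + 1)%N]/1%N /= tuple1E !app_cochain_l1 /=.
  case: (d _) (hx (s ord0)) => n hF.
    by rewrite (l1_tot_l1_tot M nz2 hF) scaler0.
  by rewrite (homogeneous_negz hF) !l1_tot0 scaler0.
- rewrite big_nat_recl // big_nat1 sum_shuffles21 shuffles22 big_set1.
  cbv zeta; rewrite -[(2 - 1 + 1)%N]/2%N -[(2 - 2 + 1)%N]/1%N /= !tuple2E.
  rewrite !(app_cochain_l1, app_cochain_l2) /=.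
  rewrite koszul1 !perm1 !scale1r koszul2 /swap2 tpermL tpermR /=.
  move: (hx ord0) (hx (lift ord0 ord0)).
  move: (tnth x ord0) (tnth x (lift ord0 ord0)) => F G.
  case: (d ord0) (d (lift ord0 ord0)) => [a|a] [b|b] hF hG.
  + have := l1_tot_l2_tot M hF hG; rewrite mulrC exprz_natM => <-.
    by rewrite [LHS]addrC addrA.
  + by rewrite (homogeneous_negz hG) ?(tot0E M).
  + by rewrite (homogeneous_negz hF) ?(tot0E M).
  + by rewrite (homogeneous_negz hF) ?(tot0E M).
- rewrite big_nat_recl // big1 ?add0r => [|s _]; last first.
    by cbv zeta; rewrite app_cochain_l_ge3 ?scaler0.
  rewrite big_nat_recl // big_nat1.
  rewrite [X in _ + X]big1 ?addr0 => [|s _]; last first.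
    by rewrite /= (app_cochain_l_ge3 _ (k := 3)) // app_cochain_l0 scaler0.
  have [s0 s1 s2] := swap3E; have [r0 r1 r2] := rot3E.
  rewrite sum_shuffles32 -[(3 - 2 + 1)%N]/2%N /= !tuple3E !app_cochain_l2 /=.
  rewrite koszul1 !koszul3 !perm1 s0 s1 s2 r0 r1 r2 /= !scale1r ?mul1r ?mulr1.
  move: (hx ord0) (hx ord3_1) (hx ord3_2).
  move: (tnth x ord0) (tnth x ord3_1) (tnth x ord3_2) => F G H.
  (* an element of negative degree is 0 *)
  case: (d ord0) (d ord3_1) (d ord3_2) => [a|a] [b|b] [c|c] hF hG hH;
    try by rewrite ?(homogeneous_negz hF) ?(homogeneous_negz hG)
      ?(homogeneous_negz hH) ?(tot0E M).
  have := l2_tot_jacobi M hF hG hH.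
  rewrite mulnDr exprD !exprz_natM.
  by rewrite [(c * b)%N]mulnC [(b * a)%N]mulnC [(c * a)%N]mulnC.
- rewrite big_nat_cond big1 // => i /andP[/andP[i_gt0 iN] _].
  rewrite big1 // => s _ /=.
  have [i2|i3] := leqP i 2.
    by rewrite app_cochain_l_ge3 ?scaler0 //; lia.
  by rewrite [X in X :: _]app_cochain_l_ge3 // app_cochain_l0 scaler0.
Qed.

End Structure.

Section MaurerCartan.
Variables (K : fieldType) (A B : lmodType K) (M : matched_pair A B).
Variable r : {linear B -> A}.
Local Notation alpha := (cochain_of_linear r).

Lemma cochain_of_linear_homogeneous : homogeneous 0 alpha.
Proof. by move=> e ne0; rewrite /= dfwith_out // eq_sym. Qed.

Lemma cfun_cochain_of_linear :
  cfun alpha = fun s => if s is [:: x] then r x else 0.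
Proof.
apply/funext => s; rewrite /cfun; case: s => [//|x [|y s]].
  by rewrite /= dfwith_in /app /= /thead tnth_mktuple.
by rewrite /= dfwith_out.
Qed.

(** Only the brackets of arity 1 and 2 contribute to the sum. *)
Lemma maurer_cartan_l1_l2 :
  maurer_cartan (cochain_l M) alpha <->
  l1_tot M alpha + 2%:R^-1 *: l2_tot M alpha alpha = 0.
Proof.
have E1 : cochain_l M [tuple alpha | i < 1] = l1_tot M alpha.
  by rewrite /= tnth_mktuple.
have E2 : cochain_l M [tuple alpha | i < 2] = l2_tot M alpha alpha.
  by rewrite /= !tnth_mktuple.
split=> [[_ [n [vanish sum0]]]|mc].
  case: n vanish sum0 => [|[|n]] vanish.
  - by rewrite -E1 -E2 !vanish // scaler0 addr0.
  - rewrite big_nat1 invr1 scale1r => E; rewrite -E1 -E2 E (vanish 2%N) //.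
    by rewrite scaler0 addr0.
  rewrite big_ltn // (big_ltn (m := 2)) //.
  rewrite [X in _ + (_ + X)]big_nat_cond [X in _ + (_ + X)]big1.
    by rewrite addr0 E1 E2 invr1 scale1r.
  move=> k /andP[/andP[k2 _] _].
  by case: k k2 => [|[|[|k]]] //; rewrite /= scaler0.
split; first exact: cochain_of_linear_homogeneous.
exists 2%N; split; first by case=> [|[|[|k]]].
rewrite (big_ltn (m := 1)) // (big_ltn (m := 2)) // big_geq // addr0 E1 E2.
by rewrite invr1 scale1r.
Qed.

Lemma l1_l2_deformation : 2%:R != 0 :> K ->
  deformation_map M r <->
  l1_tot M alpha + 2%:R^-1 *: l2_tot M alpha alpha = 0.
Proof.
move=> nz2; have hr := cochain_of_linear_homogeneous.
set r' := fun s : seq B => if s is [:: x] then r x else 0.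
have rD u v : r (u + v) = r u + r v by exact: linearD.
have rB u v : r (u - v) = r u - r v by exact: linearB.
have rZ a u : r (a *: u) = a *: r u by exact: linearZ.
have E x y : cfun (l1_tot M alpha + 2%:R^-1 *: l2_tot M alpha alpha) [:: x; y] =
    mp_mu M (r x) (r y) + mp_lh M (r x) y + mp_rh M x (r y)
    - r (mp_nu M x y + mp_tr M (r x) y + mp_tl M x (r y)).
  rewrite linearD linearZ /= fctDE fctZE.
  rewrite (cfun_l1_tot M hr) (cfun_l2_tot M hr hr).
  rewrite cfun_cochain_of_linear -/r' /bracket1 /bracket2 /bra /actL /dif.
  rewrite !(fctDE, fctNE, fctZE) !ins_cons /prodB /hat.
  rewrite !(fctDE, fctNE, fctZE) /cup /=.
  rewrite !rB !rZ !rD !expr1.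
  by lincomb_coefs K; repeat split; field.
split=> [def|mc x y].
  apply: cfun_inj; rewrite linear0; apply/funext => s.
  have [szs|szs] := eqVneq (size s) 2%N.
    case: s szs => [|x [|y []]] // _.
    by rewrite E def subrr.
  have s1 := bracket1_supported M (cfun_supported hr) (cfun_slotwise alpha).
  have s2 := bracket2_supported M (cfun_supported hr) (cfun_slotwise alpha)
    (cfun_supported hr) (cfun_slotwise alpha).
  rewrite linearD linearZ /= fctDE fctZE.
  rewrite (cfun_l1_tot M hr) (cfun_l2_tot M hr hr).
  by rewrite s1 // s2 // scaler0 addr0.
by apply/eqP; rewrite -subr_eq0 -E mc linear0.
Qed.

End MaurerCartan.

Theorem proposition7p2 (K : fieldType) (charK : [pchar K] =i pred0)
    (A B : lmodType K) (M : matched_pair A B) :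
  is_Linfty (cochain_l M) /\
  forall r : {linear B -> A},
    deformation_map M r <-> maurer_cartan (cochain_l M) (cochain_of_linear r).
Proof.
have nz2 : 2%:R != 0 :> K.
  by apply/negP => two0; have := charK 2%N; rewrite !inE two0.
split; last first.
  move=> r; apply: iff_trans (iff_sym (maurer_cartan_l1_l2 M r)).
  exact: l1_l2_deformation.
split.
- exact: cochain_l_multilinear.
- exact: cochain_l_degree.
- exact: cochain_l_symmetric.
- by move=> N d x; exact: cochain_l_jacobi.
Qed.
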